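(* Let $n\ge1$ and let $x=(x_1,\dots,x_n)$, $y=(y_1,\dots,y_n)$ be indeterminates. Then \begin{align*} A_{\mathrm V}(2n+1;x,y;\zeta_4)&=2^{-2n^2+2n}\prod_{i=1}^n x_i^{-2n+2}y_i^{-2n+2}\prod_{i,j=1}^n(x_i^2+y_j^2)(1+x_i^2y_j^2)\,\operatorname{perm}\Big(\frac{1}{(x_i^2+y_j^2)(1+x_i^2y_j^2)}\Big)_{1\le i,j\le n},\\ A_{\mathrm V}(2n+1;x,y;\zeta_6)&=3^{-n(n-1)}\,\mathrm{Sp}_{4n}\big(\delta(n-1,n-1);x_1^2,\dots,x_n^2,y_1^2,\dots,y_n^2\big),\\ A_{\mathrm V}(2n+1;x,y;\zeta_8)&=2^{-n(n-1)}\prod_{i=1}^n x_i^{-2n+2}y_i^{-2n+2}\prod_{1\le i<j\le n}(x_i^2+x_j^2)(1+x_i^2x_j^2)(y_i^2+y_j^2)(1+y_i^2y_j^2),\\ A_{\mathrm V}(2n+1;x,x;\zeta_{12})&=\frac{1}{\prod_{i=1}^n(x_i^2+x_i^{-2})}\,\tilde{\mathrm O}_{2n+1}\big(\delta(n/2,n/2-1);x_1^4,\dots,x_n^4\big)\,\tilde{\mathrm O}_{2n+1}\big(\delta((n-1)/2,(n-1)/2);x_1^4,\dots,x_n^4\big). \end{align*}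
   Context: $\sigma(t)=t-t^{-1}$, $\zeta_m=\exp(2\pi\sqrt{-1}/m)$. For a parameter $a$ let $M_{\mathrm U}(n;x,y;a)$ be the $n\times n$ matrix with entries $\dfrac{1}{\sigma(ax_i/y_j)\sigma(ay_j/x_i)}-\dfrac{1}{\sigma(ax_iy_j)\sigma(a/(x_iy_j))}$, let $F_{\mathrm V}(n;x,y;a)=\dfrac{\prod_{i,j=1}^n\sigma(ax_i/y_j)\sigma(ay_j/x_i)\sigma(ax_iy_j)\sigma(a/(x_iy_j))}{\prod_{1\le i<j\le n}\sigma(x_j/x_i)\sigma(y_i/y_j)\prod_{1\le i\le j\le n}\sigma(1/(x_ix_j))\sigma(y_iy_j)}$, and $A_{\mathrm V}(2n+1;x,y;a)=\sigma(a)^{-2n^2+2n}F_{\mathrm V}(n;x,y;a)\det M_{\mathrm U}(n;x,y;a)$; $A_{\mathrm V}(2n+1;x,x;a)$ is this with $y=x$. $\operatorname{perm}$ is the permanent. Sequences: for $r\in\mathbb Z_{\ge0}$ or $r\in\mathbb Z_{\ge0}+\tfrac12$, $\delta(r)=(r,r-1,r-2,\dots)$ consists of all $r-k\ge0$, $k\in\mathbb Z_{\ge0}$ (empty if $r<0$); $\delta(r,s)$ arranges the entries of $\delta(r)$ and $\delta(s)$ together in non-increasing order. As the index of a character in $N$ variables, such a sequence is replaced by its first $N$ entries (padded with zeros if shorter). Characters, for $\lambda=(\lambda_1\ge\dots\ge\lambda_N)$ with all $\lambda_i\in\mathbb Z_{\ge0}$ or all $\lambda_i\in\mathbb Z_{\ge0}+\frac12$,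 and $z=(z_1,\dots,z_N)$: $\mathrm{Sp}_{2N}(\lambda;z)=\det\big(z_i^{\lambda_j+N-j+1}-z_i^{-(\lambda_j+N-j+1)}\big)/\det\big(z_i^{N-j+1}-z_i^{-(N-j+1)}\big)$ (for integer $\lambda$), and $\tilde{\mathrm O}_{2N+1}(\lambda;z)=\det\big(z_i^{\lambda_j+N-j+1/2}-z_i^{-(\lambda_j+N-j+1/2)}\big)/\det\big(z_i^{N-j+1/2}-z_i^{-(N-j+1/2)}\big)$. Here the variables are $z_i=x_i^4$, and $z_i^{r}$ for half-integer $r$ means $x_i^{4r}$. *)

(* Defs.v *)
From HB Require Import structures.
From mathcomp Require Import all_boot all_order all_algebra all_fingroup.
From mathcomp Require Import fraction.
From mathcomp Require Import reals sequences exp trigo.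
From mathcomp Require Import complex.
(* without its notations, which clash with those of mathcomp-analysis *)
From mathcomp.multinomials Require Import -(notations) mpoly.

Set Implicit Arguments.
Unset Strict Implicit.
Unset Printing Implicit Defensive.

Import Order.TTheory GRing.Theory Num.Theory.
Local Open Scope ring_scope.

Definition cexp (R : realType) (z : R[i]) : R[i] :=
  (expR (complex.Re z) * cos (complex.Im z)
   +i* (expR (complex.Re z) * sin (complex.Im z)))%C.

Definition zeta (R : realType) (m : nat) : R[i] :=
  cexp ((2 * pi)%:C%C * 'i%C / m%:R).

(* The field C(X_0, ..., X_(N-1)) of rational functions; the indeterminates
   x_1, ..., x_n, y_1, ..., y_n are X_0, ..., X_(n-1), X_n, ..., X_(2n-1). *)
Definition ratfun (R : realType) (N : nat) : fieldType :=
  {fraction (mpoly.mpoly N R[i])}.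

Definition ratfunC (R : realType) (N : nat) (c : R[i]) : ratfun R N :=
  FracField.tofrac (mpoly.mpolyC N c).

Definition indet (R : realType) (N : nat) (k : 'I_N) : ratfun R N :=
  FracField.tofrac (mpoly.mpolyX R[i] (mpoly.mnm1 k)).

Definition xvar (R : realType) (n : nat) (i : 'I_n) : ratfun R (n + n) :=
  indet R (lshift n i).

Definition yvar (R : realType) (n : nat) (i : 'I_n) : ratfun R (n + n) :=
  indet R (rshift n i).

Section Field.
Variable K : fieldType.

Definition sigma (t : K) : K := t - t^-1.

Definition permanent (n : nat) (A : 'M[K]_n) : K :=
  \sum_(s : 'S_n) \prod_(i < n) A i (s i).

Definition MU (n : nat) (x y : 'I_n -> K) (a : K) : 'M[K]_n :=
  \matrix_(i < n, j < n)
    (1 / (sigma (a * x i / y j) * sigma (a * y j / x i))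
     - 1 / (sigma (a * x i * y j) * sigma (a / (x i * y j)))).

Definition FV (n : nat) (x y : 'I_n -> K) (a : K) : K :=
  (\prod_(i < n) \prod_(j < n)
     (sigma (a * x i / y j) * sigma (a * y j / x i)
      * sigma (a * x i * y j) * sigma (a / (x i * y j))))
  / ((\prod_(i < n) \prod_(j < n | (i < j)%N)
        (sigma (x j / x i) * sigma (y i / y j)))
     * (\prod_(i < n) \prod_(j < n | (i <= j)%N)
          (sigma (1 / (x i * x j)) * sigma (y i * y j)))).

(* [AV x y a] is A_V(2n+1; x, y; a). *)
Definition AV (n : nat) (x y : 'I_n -> K) (a : K) : K :=
  sigma a ^ (- (2 * n%:Z ^+ 2) + 2 * n%:Z) * FV x y a * \det (MU x y a).

End Field.

(* For r >= -1 the number of k >= 0 with r - k >= 0 is the integral part of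
   r + 1; truncn is 0 on negative numbers, so r < 0 gives the empty sequence. *)
Definition delta (r : rat) : seq rat :=
  [seq r - k%:R | k <- iota 0 (Num.truncn (r + 1))].

Definition delta2 (r s : rat) : seq rat :=
  sort (fun u v => v <= u) (delta r ++ delta s).

Section Characters.
Variable K : fieldType.

(* The index [lam] of a character in N variables is read through [lam`_j] with
   j < N: entries beyond the N-th are ignored and missing ones are 0. As j
   starts at 0, [N - j] is the N - j + 1 of the usual 1-based formulas. *)

(* The power z^r for an integral r; the floor only changes the type of r. *)
Definition zpow (z : K) (r : rat) : K := z ^ Num.floor r.

Definition Sp (N : nat) (lam : seq rat) (z : 'I_N -> K) : K :=
  \det (\matrix_(i < N, j < N)
          (zpow (z i) (lam`_j + (N - j)%:R)
           - zpow (z i) (- (lam`_j + (N - j)%:R))))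
  / \det (\matrix_(i < N, j < N)
            (zpow (z i) (N - j)%:R - zpow (z i) (- (N - j)%:R))).

(* [Ot lam x] is the character \tilde O_{2N+1}(lam; x_1^4, ..., x_N^4): its
   variables are z_i = x_i^4, and z_i^r, for r in (1/2)Z, means x_i^(4r). *)
Definition Ot (N : nat) (lam : seq rat) (x : 'I_N -> K) : K :=
  \det (\matrix_(i < N, j < N)
          (zpow (x i) (4 * (lam`_j + (N - j)%:R - 1 / 2))
           - zpow (x i) (- (4 * (lam`_j + (N - j)%:R - 1 / 2)))))
  / \det (\matrix_(i < N, j < N)
            (zpow (x i) (4 * ((N - j)%:R - 1 / 2))
             - zpow (x i) (- (4 * ((N - j)%:R - 1 / 2))))).

(* The concatenation (u_1, ..., u_m, v_1, ..., v_n). *)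
Definition joinv (m n : nat) (u : 'I_m -> K) (v : 'I_n -> K) (k : 'I_(m + n)) : K :=
  match split k with inl i => u i | inr j => v j end.

End Characters.

(* Main.v *)
Require Import Defs.
From HB Require Import structures.
From mathcomp Require Import all_boot all_order all_algebra all_fingroup.
From mathcomp Require Import fraction.
From mathcomp Require Import reals sequences exp trigo.
From mathcomp Require Import complex.
From mathcomp.multinomials Require Import -(notations) mpoly.
From mathcomp Require Import ring zify lra.
Set Implicit Arguments.
Unset Strict Implicit.
Unset Printing Implicit Defensive.
Import Order.TTheory GRing.Theory Num.Theory.
Local Open Scope ring_scope.

(** Put u = x^2 + x^-2, v = y^2 + y^-2 and c = a^2 + a^-2. Then the entries of
    M_U and the factors of F_V combine into the quadratic form
    D(u, v) = u^2 + v^2 - c u v + c^2 - 4, and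
      A_V = (c - 2)^(-n(n-1)) prod D(u_i, v_j) det(1 / D(u_i, v_j))
            / prod_(i < j) (u_i - u_j) (v_i - v_j).
    The four roots of unity give c = -2, -1, 0, 1.
    For c = -2, D = (u + v)^2 and Borchardt's identity applies.
    For c = 0, D = (u^2 - 4) + v^2 and the determinant is Cauchy's.
    For c = -1, D = (U - V) / (u - v) with U = u^3 - 3 u = x^6 + x^-6, and
    det((u_i - v_j) / (U_i - V_j)) is, up to elementary factors, the
    determinant of order 2n with columns U^k, u U^k, which is the numerator of
    the symplectic character after a unitriangular change of columns.
    For c = 1 and y = x, D = (U + U') / (u + u'), and the same determinant of
    order 2n splits by parity in u into two determinants of order n, the
    numerators of the two orthogonal characters. *)

(** * Cauchy and Borchardt determinants *)

Section Determinants.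
Variable K : fieldType.

Lemma det_scale_rows n (d : 'I_n -> K) (A : 'I_n -> 'I_n -> K) :
  \det (\matrix_(i, j) (d i * A i j)) = (\prod_i d i) * \det (\matrix_(i, j) A i j).
Proof.
have -> : \matrix_(i, j) (d i * A i j) = diag_mx (\row_i d i) *m \matrix_(i, j) A i j.
  by apply/matrixP => i j; rewrite mul_diag_mx !mxE.
by rewrite det_mulmx det_diag; congr (_ * _); apply: eq_bigr => i _; rewrite mxE.
Qed.

Lemma det_scale_cols n (d : 'I_n -> K) (A : 'I_n -> 'I_n -> K) :
  \det (\matrix_(i, j) (d j * A i j)) = (\prod_i d i) * \det (\matrix_(i, j) A i j).
Proof.
rewrite -det_tr -[in RHS]det_tr.
have -> : (\matrix_(i, j) (d j * A i j))^T = \matrix_(i, j) (d i * A j i).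
  by apply/matrixP => i j; rewrite !mxE.
by rewrite det_scale_rows; congr (_ * \det _); apply/matrixP => i j; rewrite !mxE.
Qed.

Definition powmx n (X : 'I_n -> K) : 'M[K]_n := \matrix_(i, j) X i ^+ j.

Lemma det_powmx n (X : 'I_n -> K) :
  \det (powmx X) = \prod_(i < n) \prod_(j < n | (i < j)%N) (X j - X i).
Proof.
rewrite -det_tr (_ : (powmx X)^T = Vandermonde n (\row_j X j)).
  rewrite det_Vandermonde; apply: eq_bigr => i _; apply: eq_bigr => j _.
  by rewrite !mxE.
by apply/matrixP => i j; rewrite !mxE.
Qed.

Lemma det_powmx_neq0 n (X : 'I_n -> K) :
  injective X -> \det (powmx X) != 0.
Proof.
move=> injX; rewrite det_powmx; apply/prodf_neq0 => i _; apply/prodf_neq0 => j ij.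
by rewrite subr_eq0; apply: contraTneq ij => /injX ->; rewrite ltnn.
Qed.

(** The Lagrange basis polynomial at the node [Y j], without its normalisation. *)
Definition nodal n (Y : 'I_n -> K) (j : 'I_n) : {poly K} :=
  \prod_(k | k != j) ('X - (Y k)%:P).

Lemma horner_nodal n (Y : 'I_n -> K) j z :
  (nodal Y j).[z] = \prod_(k | k != j) (z - Y k).
Proof. by rewrite horner_prod; apply: eq_bigr => k _; rewrite !hornerE. Qed.

Lemma size_nodal n (Y : 'I_n -> K) j : size (nodal Y j) = n.
Proof.
rewrite /nodal -big_filter size_prod_XsubC size_filter -sum1_count.
case: n Y j => [|n] Y j; first by case: j.
have := cardC1 j; rewrite card_ord /= -sum1_card => cj; congr _.+1.
by rewrite -[RHS]cj; apply: eq_bigl => k; rewrite !inE.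
Qed.

(** Coefficients stand in columns, so that left multiplication by [powmx X] evaluates the nodal
    polynomials at the points [X i]. *)
Definition nodalmx n (Y : 'I_n -> K) : 'M[K]_n := \matrix_(k, j) (nodal Y j)`_k.

Lemma powmx_nodalmx n (X Y : 'I_n -> K) :
  powmx X *m nodalmx Y = \matrix_(i, j) \prod_(k | k != j) (X i - Y k).
Proof.
apply/matrixP => i j; rewrite !mxE -horner_nodal.
rewrite (@horner_coef_wide _ n) ?size_nodal //.
by apply: eq_bigr => k _; rewrite !mxE mulrC.
Qed.

Lemma powmx_nodalmx_diag n (Y : 'I_n -> K) :
  powmx Y *m nodalmx Y = diag_mx (\row_j \prod_(k | k != j) (Y j - Y k)).
Proof.
rewrite powmx_nodalmx; apply/matrixP => i j; rewrite !mxE.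
have [->|ij] := eqVneq i j; first by rewrite mulr1n.
by rewrite mulr0n (bigD1 i) //= subrr mul0r.
Qed.

(** Each ordered pair of distinct indices is grouped with its transpose. *)
Lemma prod_ltn_gtn n (F : 'I_n -> 'I_n -> K) :
  \prod_j \prod_(k | k != j) F j k
  = \prod_(i < n) \prod_(j < n | (i < j)%N) (F i j * F j i).
Proof.
rewrite [RHS](eq_bigr _ (fun i _ => big_split _ _ _ _ _)) big_split /=.
rewrite [X in _ = _ * X](exchange_big_dep xpredT) //= -big_split /=.
apply: eq_bigr => j _; rewrite (bigID (fun k : 'I_n => (j < k)%N)) /=.
by congr (_ * _); apply: eq_bigl => k; rewrite -val_eqE /=; case: ltngtP.
Qed.

Lemma prod_nodal n (Y : 'I_n -> K) :
  \prod_j \prod_(k | k != j) (Y j - Y k)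
  = (\prod_(i < n) \prod_(j < n | (i < j)%N) (Y i - Y j)) * \det (powmx Y).
Proof.
rewrite det_powmx prod_ltn_gtn -big_split; apply: eq_bigr => i _.
by rewrite -big_split.
Qed.

(** Evaluating at the nodes themselves gives a diagonal matrix. The Vandermonde determinant is
    nonzero for distinct nodes and can be cancelled from its determinant. *)
Lemma det_nodalmx n (Y : 'I_n -> K) : injective Y ->
  \det (nodalmx Y) = \prod_(i < n) \prod_(j < n | (i < j)%N) (Y i - Y j).
Proof.
move=> injY; apply: (mulfI (det_powmx_neq0 injY)).
rewrite -det_mulmx powmx_nodalmx_diag det_diag [RHS]mulrC -prod_nodal.
by apply: eq_bigr => i _; rewrite mxE.
Qed.

(** Row i absorbs the product of its denominators. The numerators are arbitrary because the
    determinants of order 2n below need [a i - b j]. *)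
Lemma cauchy_rows n (X Y : 'I_n -> K) (a : 'I_n -> 'I_n -> K) :
  (forall i j, X i - Y j != 0) ->
  (\prod_(i < n) \prod_(j < n) (X i - Y j)) * \det (\matrix_(i, j) (a i j / (X i - Y j)))
  = \det (\matrix_(i, j) (a i j * \prod_(k | k != j) (X i - Y k))).
Proof.
move=> XY; rewrite -det_scale_rows; congr (\det _); apply/matrixP => i j.
by rewrite !mxE (bigD1 j) //=; field.
Qed.

(** With all numerators 1 the cleared matrix factors as [powmx X *m nodalmx Y]. *)
Lemma cauchy_det n (X Y : 'I_n -> K) : injective Y ->
  (forall i j, X i - Y j != 0) ->
  (\prod_(i < n) \prod_(j < n) (X i - Y j)) * \det (\matrix_(i, j) (1 / (X i - Y j)))
  = (\prod_(i < n) \prod_(j < n | (i < j)%N) (X j - X i))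
    * \prod_(i < n) \prod_(j < n | (i < j)%N) (Y i - Y j).
Proof.
move=> injY XY; rewrite cauchy_rows // -det_powmx -det_nodalmx // -det_mulmx.
by rewrite powmx_nodalmx; congr (\det _); apply/matrixP => i j; rewrite !mxE mul1r.
Qed.

(** This is the case Y = -v, where the signs of the two differences cancel. *)
Lemma cauchy_det_add n (u v : 'I_n -> K) : injective v ->
  (forall i j, u i + v j != 0) ->
  (\prod_(i < n) \prod_(j < n) (u i + v j)) * \det (\matrix_(i, j) (1 / (u i + v j)))
  = \prod_(i < n) \prod_(j < n | (i < j)%N) ((u i - u j) * (v i - v j)).
Proof.
move=> injv uv.
have := @cauchy_det n u (fun j => - v j) (inj_comp oppr_inj injv) _.
under eq_bigr do under eq_bigr do rewrite opprK.
have -> : \matrix_(i, j) (1 / (u i - - v j)) = \matrix_(i, j) (1 / (u i + v j)).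
  by apply/matrixP => i j; rewrite !mxE opprK.
move=> ->; last by move=> i j; rewrite opprK.
rewrite -big_split; apply: eq_bigr => i _; rewrite -big_split; apply: eq_bigr => j _ /=; ring.
Qed.

(* Expanding det * perm over pairs of permutations and grouping them by their
   quotient p, the group of p is the determinant below; for p != 1 its rows
   satisfy a relation with weights X (p i) - X i, because
   (B - A) / (A * B) = 1 / A - 1 / B. *)
Lemma borchardt_vanish n (X Y : 'I_n -> K) (p : 'S_n) : injective X ->
  (forall i j, X i - Y j != 0) -> p != 1%g ->
  \det (\matrix_(i, j) (1 / (X i - Y j) * (1 / (X (p i) - Y j)))) = 0.
Proof.
move=> injX XY p1; apply/eqP/det0P.
exists (\row_i (X (p i) - X i)).
  apply: contraNneq p1 => w0; apply/eqP/permP => i; rewrite perm1.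
  by apply: injX; apply/eqP; rewrite -subr_eq0; have := congr1 (fun r : 'rV_n => r 0 i) w0; rewrite !mxE => ->.
apply/rowP => j; rewrite !mxE.
have -> : \sum_k (\row_i (X (p i) - X i)) 0 k *
   (\matrix_(i, j0) (1 / (X i - Y j0) * (1 / (X (p i) - Y j0)))) k j
   = \sum_k (1 / (X k - Y j) - 1 / (X (p k) - Y j)).
  by apply: eq_bigr => k _; rewrite !mxE; field; rewrite !XY.
rewrite sumrB [X in _ - X](_ : _ = \sum_k 1 / (X k - Y j)) ?subrr //.
by rewrite [RHS](reindex_inj (@perm_inj _ p)).
Qed.

Lemma borchardt n (X Y : 'I_n -> K) : injective X ->
  (forall i j, X i - Y j != 0) ->
  \det (\matrix_(i, j) (1 / (X i - Y j) ^+ 2))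
  = \det (\matrix_(i, j) (1 / (X i - Y j))) * permanent (\matrix_(i, j) (1 / (X i - Y j))).
Proof.
move=> injX XY; set B := \matrix_(i, j) (1 / (X i - Y j)).
(* Only the identity permutation contributes to this sum, by [borchardt_vanish]. *)
transitivity (\sum_(p : 'S_n) \det (\matrix_(i, j) (1 / (X i - Y j) * (1 / (X (p i) - Y j))))).
  rewrite (bigD1 1%g) //= [X in _ + X]big1 ?addr0; last by move=> p; apply: borchardt_vanish.
  congr (\det _); apply/matrixP => i j; rewrite !mxE perm1; field; exact: XY.
rewrite /determinant exchange_big mulr_suml; apply: eq_bigr => s _ /=.
rewrite -big_distrr /= -mulrA; congr (_ * _).
(* The permutation of the permanent is written [p^-1 * s]; reindexing the rows by p then gives the
   factors [1 / (X (p i) - Y (s i))]. *)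
rewrite /permanent [in RHS](reindex_inj (inj_comp (mulIg s) invg_inj)) /=.
rewrite big_distrr; apply: eq_bigr => p _ /=.
under eq_bigr do rewrite !mxE.
rewrite big_split; congr (_ * _); first by apply: eq_bigr => i _; rewrite mxE.
rewrite [RHS](reindex_inj (@perm_inj _ p)); apply: eq_bigr => i _.
by rewrite !mxE permM permK.
Qed.

End Determinants.

(** * Determinants with columns [X^k] and [a X^k] *)

Section DoubleDeterminants.
Variable K : fieldType.

(* Multiplying by the coefficients of the nodal polynomials of Y diagonalises
   the lower blocks, and a column operation then makes one of them vanish. *)
Lemma det_double_powmx n (X Y a b : 'I_n -> K) : injective Y ->
  (forall i j, X i - Y j != 0) ->
  \det (block_mx (diag_mx (\row_i a i) *m powmx X) (powmx X)
                 (diag_mx (\row_i b i) *m powmx Y) (powmx Y))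
  = (\prod_(i < n) \prod_(j < n | (i < j)%N) (-1))
    * ((\prod_(i < n) \prod_(j < n) (X i - Y j))
       * \det (\matrix_(i, j) ((a i - b j) / (X i - Y j)))).
Proof.
move=> injY XY; have cY := det_nodalmx injY; set C := nodalmx Y in cY.
(* The sign (-1)^(n(n-1)/2) that reverses all differences in a Vandermonde product. *)
set s := \prod_(i < n) \prod_(j < n | _) -1.
have sV : \det C = s * \det (powmx Y).
  rewrite cY /s det_powmx -big_split; apply: eq_bigr => i _ /=.
  by rewrite -big_split; apply: eq_bigr => j _ /=; ring.
have C0 : \det C != 0.
  have s0 : s != 0.
    by apply/prodf_neq0 => i _; apply/prodf_neq0 => j _; rewrite oppr_eq0 oner_neq0.
  by rewrite sV mulf_neq0 ?det_powmx_neq0.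
apply: (mulIf (mulf_neq0 C0 C0)).
set M := block_mx _ _ _ _.
have dC : \det (block_mx C 0 0 C) = \det C * \det C by rewrite det_ublock.
(* This factor subtracts from the first block column the second one scaled by b. The lower left
   block cancels because diagonal matrices commute. *)
have dU : \det (block_mx 1%:M 0 (- diag_mx (\row_i b i)) 1%:M) = 1 :> K.
  by rewrite det_lblock !det1 mulr1.
rewrite -dC -det_mulmx -[LHS]mulr1 -[X in _ * X = _]dU -det_mulmx.
rewrite !mulmx_block !mulmx0 !mulmx1 !addr0 !add0r -!(mulmxA (diag_mx _)).
rewrite powmx_nodalmx_diag.
have -> : diag_mx (\row_i b i) *m diag_mx (\row_j \prod_(k | k != j) (Y j - Y k))
  + diag_mx (\row_j \prod_(k | k != j) (Y j - Y k)) *m (- diag_mx (\row_i b i)) = 0.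
  by rewrite mulmxN diag_mxC subrr.
rewrite det_ublock cauchy_rows // det_diag.
have -> : \prod_i (\row_j \prod_(k | k != j) (Y j - Y k)) 0 i = \det C * \det (powmx Y).
  by rewrite cY -prod_nodal; apply: eq_bigr => i _; rewrite mxE.
rewrite dC powmx_nodalmx mulmxN.
have -> : diag_mx (\row_i a i) *m (\matrix_(i, j) \prod_(k | k != j) (X i - Y k)) -
   (\matrix_(i, j) \prod_(k | k != j) (X i - Y k)) *m diag_mx (\row_i b i)
  = \matrix_(i, j) ((a i - b j) * \prod_(k | k != j) (X i - Y k)).
  by apply/matrixP => i j; rewrite mul_diag_mx mul_mx_diag !mxE mulrBl [_ * b j]mulrC.
have s2 : s * s = 1.
  rewrite /s -big_split big1 // => i _ /=; rewrite -big_split big1 // => j _ /=; ring.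
have -> : \det (powmx Y) = s * \det C by rewrite sV mulrA s2 mul1r.
ring.
Qed.

Lemma joinv_lshift m n (u : 'I_m -> K) (v : 'I_n -> K) i : joinv u v (lshift n i) = u i.
Proof. by rewrite /joinv (unsplitK (inl i)). Qed.

Lemma joinv_rshift m n (u : 'I_m -> K) (v : 'I_n -> K) i : joinv u v (rshift m i) = v i.
Proof. by rewrite /joinv (unsplitK (inr i)). Qed.

(** The constant is the sign of the permutation. It stays anonymous because later it either cancels
    in a quotient or is found by specialisation. *)
Lemma det_col_rearrange m (f : 'I_m -> 'I_m) : injective f ->
  exists2 e : K, e != 0 & forall A : 'I_m -> 'I_m -> K,
    \det (\matrix_(i, j) A i (f j)) = e * \det (\matrix_(i, j) A i j).
Proof.
move=> injf; exists ((-1) ^+ ((perm injf)^-1)%g); first by rewrite signr_eq0.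
move=> A; rewrite -det_perm mulrC -det_mulmx; congr (\det _).
have -> : \matrix_(i, j) A i (f j) = col_perm (perm injf) (\matrix_(i, j) A i j).
  by apply/matrixP => i j; rewrite !mxE permE.
by rewrite col_permE.
Qed.

(** The columns are 1, a, X, a X, X^2, a X^2, ..., the order in which the change of columns to
    characters is unitriangular. *)
Definition double_pow n (X a : 'I_(n + n) -> K) (i k : 'I_(n + n)) : K :=
  X i ^+ k./2 * a i ^+ odd k.

(** Places the two column blocks a X^k and X^k at the odd and the even positions of [double_pow]. *)
Definition interleave n (k : 'I_(n + n)) : nat :=
  match split k with inl k => k.*2.+1 | inr k => k.*2 end.

Lemma interleave_subproof n (k : 'I_(n + n)) : (interleave k < n + n)%N.
Proof. by rewrite /interleave; case: split => j; have := ltn_ord j; lia. Qed.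

Definition interleave_ord n (k : 'I_(n + n)) := Ordinal (interleave_subproof k).

Lemma interleave_inj n : injective (@interleave_ord n).
Proof.
move=> k l /(congr1 val) /=; rewrite /interleave.
case: splitP => i ki; case: splitP => j lj e; apply/val_inj => /=; lia.
Qed.

(** The constant is chosen before X, Y, a, b, so it cancels between the numerator and the
    denominator of a character. *)
Lemma det_double_pow n :
  exists2 e : K, e != 0 & forall X Y a b : 'I_n -> K, injective Y ->
  (forall i j, X i - Y j != 0) ->
  \det (\matrix_(i, j) double_pow (joinv X Y) (joinv a b) i j)
  = e * ((\prod_(i < n) \prod_(j < n) (X i - Y j))
       * \det (\matrix_(i, j) ((a i - b j) / (X i - Y j)))).
Proof.
have [e e0 He] := det_col_rearrange (@interleave_inj n).
have s0 : \prod_(i < n) \prod_(j < n | (i < j)%N) (-1) != 0 :> K.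
  by apply/prodf_neq0 => i _; apply/prodf_neq0 => j _; rewrite oppr_eq0 oner_neq0.
exists (e^-1 * \prod_(i < n) \prod_(j < n | (i < j)%N) (-1)).
  by rewrite mulf_neq0 ?invr_eq0.
move=> X Y a b injY XY; rewrite -mulrA -det_double_powmx //.
apply: (mulfI e0); rewrite mulVKf // -He; congr (\det _).
apply/matrixP => i k; rewrite mxE /double_pow /= /interleave.
rewrite -(splitK i) -(splitK k); case: (split i) => i'; case: (split k) => k';
 rewrite ?unsplitK /= ?block_mxEul ?block_mxEur ?block_mxEdl ?block_mxEdr
   ?joinv_lshift ?joinv_rshift ?mul_diag_mx ?mxE ?uphalf_double ?doubleK
   ?oddS ?odd_double /= ?expr0 ?expr1 ?mulr1 //; exact: mulrC.
Qed.

(** Exchanges the even columns of the two blocks. In the blocks a X^k and X^k this gathers on the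
    left the monomials that are even under (X, a) -> (-X, -a), and on the right the odd ones. *)
Definition swap_parity n (k : 'I_(n + n)) : 'I_(n + n) :=
  match split k with
  | inl j => if odd j then lshift n j else rshift n j
  | inr j => if odd j then rshift n j else lshift n j
  end.

Lemma swap_parity_inj n : injective (@swap_parity n).
Proof.
move=> k l; rewrite -(splitK k) -(splitK l) /swap_parity.
case: (split k) => k'; case: (split l) => l'; rewrite ?unsplitK /=;
 case: ifP => ok; case: ifP => ol; move/(congr1 val) => /= e;
 have kn := ltn_ord k'; have ln := ltn_ord l'; apply/val_inj => /=; lia.
Qed.

(** For [b = false] the monomials are even under (X, a) -> (-X, -a); for [b = true] they are odd. *)
Definition parity_pow n (b : bool) (X a : 'I_n -> K) (i k : 'I_n) : K :=
  X i ^+ k * a i ^+ (odd k (+) b).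

Lemma det_sym_block n (E F : 'M[K]_n) :
  \det (block_mx E F E (- F)) = (-2) ^+ n * (\det E * \det F).
Proof.
have -> : block_mx E F E (- F) = block_mx 1%:M 0 1%:M 1%:M *m block_mx E F 0 ((-2) *: F).
  rewrite mulmx_block !mul1mx !mul0mx !addr0.
  by congr block_mx; apply/matrixP => i j; rewrite !mxE; ring.
by rewrite det_mulmx det_lblock !det1 !mul1r det_ublock detZ mulrCA.
Qed.

(** Take Y = -X and b = -a in [det_double_powmx]. Once the columns are sorted by parity, the lower
    rows repeat the upper ones up to the sign of the odd half, and the determinant splits. *)
Lemma det_add_quotient_const n :
  exists e : K, forall X a : 'I_n -> K, injective X ->
  (forall i j, X i + X j != 0) ->
  (\prod_(i < n) \prod_(j < n) (X i + X j))
     * \det (\matrix_(i, j) ((a i + a j) / (X i + X j)))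
  = e * (\det (\matrix_(i, j) parity_pow false X a i j)
         * \det (\matrix_(i, j) parity_pow true X a i j)).
Proof.
have [e e0 He] := det_col_rearrange (@swap_parity_inj n).
set s : K := \prod_(i < n) \prod_(j < n | (i < j)%N) (-1).
have s0 : s != 0.
  by apply/prodf_neq0 => i _; apply/prodf_neq0 => j _; rewrite oppr_eq0 oner_neq0.
exists ((e * s)^-1 * (-2) ^+ n) => X a injX XX.
apply: (mulfI (mulf_neq0 e0 s0)); rewrite [RHS]mulrA mulVKf ?mulf_neq0 //.
have := @det_double_powmx n X (fun i => - X i) a (fun i => - a i)
  (inj_comp oppr_inj injX).
have -> : \matrix_(i, j) ((a i - - a j) / (X i - - X j))
   = \matrix_(i, j) ((a i + a j) / (X i + X j)).
  by apply/matrixP => i j; rewrite !mxE !opprK.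
have -> : \prod_(i < n) \prod_(j < n) (X i - - X j) = \prod_(i < n) \prod_(j < n) (X i + X j).
  by apply: eq_bigr => i _; apply: eq_bigr => j _; rewrite opprK.
rewrite -/s -mulrA => <-; last by move=> i j; rewrite opprK.
set M := block_mx _ _ _ _.
have {1}-> : M = \matrix_(i, j) M i j by apply/matrixP => i j; rewrite mxE.
rewrite -He -det_sym_block; congr (\det _).
apply/matrixP => i k; rewrite mxE /swap_parity.
rewrite -(splitK i) -(splitK k); case: (split i) => i'; case: (split k) => k';
 rewrite ?unsplitK /=; case: ifP => ok;
 rewrite /M ?block_mxEul ?block_mxEur ?block_mxEdl ?block_mxEdr
    ?mul_diag_mx ?mxE /parity_pow ok /= ?expr0 ?expr1 ?mulr1 //; try exact: mulrC;
 rewrite exprNn -signr_odd ok /= ?expr1 ?expr0; ring.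
Qed.

(* With [a = 1] both sides are Cauchy determinants, which determines the constant. *)
Lemma det_add_quotient n (X a : 'I_n -> K) : injective X ->
  (forall i j, X i + X j != 0) ->
  (\prod_(i < n) \prod_(j < n) (X i + X j))
     * \det (\matrix_(i, j) ((a i + a j) / (X i + X j)))
  = 2 ^+ n * (\det (\matrix_(i, j) parity_pow false X a i j)
         * \det (\matrix_(i, j) parity_pow true X a i j)).
Proof.
move=> injX XX; have [e He] := det_add_quotient_const n.
rewrite He //; congr (_ * _).
have V b : \det (\matrix_(i, j) parity_pow b X (fun=> 1) i j) = \det (powmx X).
  by congr (\det _); apply/matrixP => i j; rewrite !mxE /parity_pow expr1n mulr1.
have := He X (fun=> 1) injX XX; rewrite !V.
have -> : \matrix_(i, j) ((1 + 1) / (X i + X j)) = 2 *: \matrix_(i, j) (1 / (X i + X j)).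
  by apply/matrixP => i j; rewrite !mxE mulrA mulr1.
rewrite detZ mulrCA cauchy_det_add //.
have V0 := det_powmx_neq0 injX.
rewrite (_ : \prod_(i < n) _ = \det (powmx X) * \det (powmx X)); last first.
  rewrite det_powmx -big_split; apply: eq_bigr => i _ /=.
  by rewrite -big_split; apply: eq_bigr => j _ /=; ring.
by move/(mulIf (mulf_neq0 V0 V0)).
Qed.
End DoubleDeterminants.

(** * Unitriangular changes of columns *)

Section UnitriangularFamilies.
Variable K : fieldType.

Section Triangular.
Variables (I : Type) (f : nat -> I -> K).

Definition span (k : nat) (g : I -> K) :=
  exists c : nat -> K, forall i, g i = \sum_(j < k) c j * f j i.

Lemma span0 k : span k (fun=> 0).
Proof. by exists (fun=> 0) => i; rewrite big1 // => j _; rewrite mul0r. Qed.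

Lemma spanD k g h : span k g -> span k h -> span k (fun i => g i + h i).
Proof.
move=> [c gE] [d hE]; exists (fun j => c j + d j) => i.
by rewrite gE hE -big_split; apply: eq_bigr => j _; rewrite mulrDl.
Qed.

Lemma spanZ k a g : span k g -> span k (fun i => a * g i).
Proof.
move=> [c gE]; exists (fun j => a * c j) => i.
by rewrite gE mulr_sumr; apply: eq_bigr => j _; rewrite mulrA.
Qed.

Lemma span_gen k j : (j < k)%N -> span k (f j).
Proof.
move=> jk; exists (fun l => (l == j)%:R) => i.
rewrite (bigD1 (Ordinal jk)) //= eqxx mul1r big1 ?addr0 // => l lj.
by rewrite (negPf (_ : (l : nat) != j)) ?mul0r //; apply: contraNneq lj => lj; apply/eqP/val_inj.
Qed.

Lemma span_ext k g h : (forall i, g i = h i) -> span k g -> span k h.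
Proof. by move=> gh [c gE]; exists c => i; rewrite -gh. Qed.

Lemma span_sum k m (F : nat -> I -> K) :
  (forall j, (j < m)%N -> span k (F j)) -> span k (fun i => \sum_(j < m) F j i).
Proof.
elim: m => [|m IH] HF.
  by apply: span_ext (span0 k) => i; rewrite big_ord0.
apply: span_ext (spanD (IH _) (HF m (ltnSn m))) => [i|j jm].
  by rewrite big_ord_recr.
by apply: HF; apply: ltnW.
Qed.

Lemma span_le k l g : (k <= l)%N -> span k g -> span l g.
Proof.
move=> kl [c gE]; apply: span_ext (fun i => esym (gE i)) _.
apply: (@span_sum l k (fun j i => c j * f j i)) => j jk.
by apply/spanZ/span_gen/(leq_trans jk).
Qed.

Lemma span_shift k d w g : (forall j i, w i * f j i = f (j + d)%N i) ->
  span k g -> span (k + d) (fun i => w i * g i).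
Proof.
move=> wf [c gE].
have wE i : \sum_(j < k) c j * f (j + d)%N i = w i * g i.
  rewrite gE mulr_sumr; apply: eq_bigr => j _; rewrite -wf; ring.
apply: (span_ext wE); apply: (@span_sum _ _ (fun j i => c j * f (j + d)%N i)) => j jk.
by apply/spanZ/span_gen; rewrite ltn_add2r.
Qed.

Definition unitriangular (t : nat -> I -> K) :=
  forall k, span k (fun i => t k i - f k i).

(** The antisymmetric powers satisfy s(m + 2p) = (z^p + z^-p) s(m + p) - s(m). In the applications
    z^p + z^-p is [w - e], where multiplication by w raises the index by d and e brings in only
    lower terms. *)
Lemma unitriangular_rec (d : nat) (w : I -> K) (e : K) (t : nat -> I -> K) :
  (0 < d)%N -> (forall j i, w i * f j i = f (j + d)%N i) ->
  (forall k, (k < d + d)%N -> span k (fun i => t k i - f k i)) ->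
  (forall k i, t (k + d + d)%N i = (w i - e) * t (k + d)%N i - t k i) ->
  unitriangular t.
Proof.
move=> d0 wf t0 tE; elim/ltn_ind => k IH.
have [kd|dk] := ltnP k (d + d); first exact: t0.
have [l kE] : exists l, k = (l + d + d)%N by exists (k - d - d)%N; lia.
rewrite {}kE in IH *; clear dk k.
have s1 : span (l + d) (fun i => t (l + d)%N i - f (l + d)%N i) by apply: IH; lia.
have s0 : span l (fun i => t l i - f l i) by apply: IH; lia.
(* The summands are w (t - f) and -e (t - f) at l + d, then -e f at l + d, then -(t - f) and -f at
   l. *)
have := spanD (span_shift wf s1) (spanD (spanZ (- e) (span_le _ s1))
  (spanD (spanZ (- e) (span_gen (_ : l + d < l + d + d)%N))
  (spanD (spanZ (- 1) (span_le _ s0)) (spanZ (- 1) (span_gen (_ : l < l + d + d)%N))))).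
move=> H; apply: span_ext (H _ _ _ _); try lia; move=> i.
by rewrite tE -(wf (l + d)%N); ring.
Qed.

End Triangular.

Lemma det_unitriangular n (f t : nat -> 'I_n -> K) : unitriangular f t ->
  \det (\matrix_(i, j) t j i) = \det (\matrix_(i, j) f j i).
Proof.
move=> tf.
have [c cE] := fin_all_exists (fun k : 'I_n => tf k).
pose T := \matrix_(k < n, j < n) (if (j < k)%N then c k j else (j == k)%:R).
have -> : \matrix_(i, j) t j i = (\matrix_(i, j) f j i) *m T^T.
  apply/matrixP => i k; rewrite !mxE.
  have -> : t k i = f k i + \sum_(j < k) c k j * f j i by rewrite -cE; ring.
  rewrite [RHS](eq_bigr (fun j : 'I_n => (if (j < k)%N then c k j * f j i else 0)
     + (if j == k then f k i else 0))); last first.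
    move=> j _; rewrite !mxE; case: ltnP => jk.
      by rewrite (negPf (_ : j != k)) ?addr0 1?mulrC // -val_eqE ltn_eqF.
    by have [->|_] := eqVneq j k; rewrite ?mulr1 ?mulr0 add0r.
  rewrite big_split /= [X in _ = _ + X]big_mkcond /= -[X in _ = _ + X]big_mkcond big_pred1_eq addrC.
  congr (_ + _); rewrite -big_mkcond /= (big_ord_widen n (fun j => c k j * f j i)) //.
  exact: ltnW.
rewrite det_mulmx det_tr (@det_trig _ _ T) ?big1 ?mulr1 //.
  by move=> i _; rewrite !mxE ltnn eqxx.
apply/is_trig_mxP => i j ij; rewrite !mxE.
by rewrite ltnNge (ltnW ij) /= -val_eqE gtn_eqF.
Qed.

(** Base cases of the recurrences are settled by an explicit list of coefficients, lowest index
    first. *)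
Lemma unitriangular_of_coef (I : Type) (f : nat -> I -> K) k (g : I -> K) (c : seq K) :
  (forall i, g i = \sum_(j < k) c`_j * f j i) -> span f k g.
Proof. by move=> gE; exists (fun j => c`_j). Qed.

Definition sympow (m : nat) (z : K) : K := z ^+ m - z ^- m.

Section Families.
Variables (I : Type) (z : I -> K).
Hypothesis z0 : forall i, z i != 0.
Let u i := z i + (z i)^-1.
Let U i := z i ^+ 3 + z i ^- 3.

Ltac base := rewrite ?big_ord_recr big_ord0 /= /u /U /sympow; field; rewrite ?z0.

(** Chebyshev polynomials of the second kind: the quotient by z - z^-1 is monic of degree k in z +
    z^-1. This treats the symplectic Weyl denominator. *)
Lemma unitriangular_weyl :
  unitriangular (fun k i => sympow 1 (z i) * u i ^+ k) (fun k i => sympow k.+1 (z i)).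
Proof.
apply: (@unitriangular_rec _ _ 1 u 0) => // [j i|[|[|//]] _|k i].
- by rewrite addn1 exprS; ring.
- by apply: (@unitriangular_of_coef _ _ _ _ [::]) => i; base.
- by apply: (@unitriangular_of_coef _ _ _ _ [:: 0]) => i; base.
- by rewrite !addn1 /sympow /u !exprS; field; rewrite expf_neq0 z0.
Qed.

(** The orthogonal analogue for odd exponents; here u^2 - 2 = z^2 + z^-2 drives the recurrence. *)
Lemma unitriangular_odd :
  unitriangular (fun k i => sympow 1 (z i) * (u i ^+ 2) ^+ k)
    (fun k i => sympow k.*2.+1 (z i)).
Proof.
apply: (@unitriangular_rec _ _ 1 (fun i => u i ^+ 2) 2) => // [j i|[|[|//]] _|k i].
- by rewrite addn1 (exprS (u i ^+ 2)); ring.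
- by apply: (@unitriangular_of_coef _ _ _ _ [::]) => i; base.
- by apply: (@unitriangular_of_coef _ _ _ _ [:: -1]) => i; base.
- by rewrite !addn1 !doubleS /sympow /u !exprS; field; rewrite expf_neq0 z0.
Qed.

(* (k./2 + k).+1 enumerates the positive integers prime to 3. *)
Lemma unitriangular_mod3 :
  unitriangular (fun k i => sympow 1 (z i) * (U i ^+ k./2 * u i ^+ odd k))
    (fun k i => sympow (k./2 + k).+1 (z i)).
Proof.
apply: (@unitriangular_rec _ _ 2 U 0) => // [j i|[|[|[|[|//]]]] _|k i].
- by rewrite addn2 /= negbK exprS; ring.
- by apply: (@unitriangular_of_coef _ _ _ _ [::]) => i; base.
- by apply: (@unitriangular_of_coef _ _ _ _ [:: 0]) => i; base.
- by apply: (@unitriangular_of_coef _ _ _ _ [:: 0; 1]) => i; base.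
- by apply: (@unitriangular_of_coef _ _ _ _ [:: 1; 0; 0]) => i; base.
- rewrite !addn2 /= !addSn !addnS /sympow /U !exprS.
  by field; rewrite expf_neq0 z0.
Qed.

(* 3 k + 1 + (odd k (+) b) enumerates the odd (b = false) or even (b = true)
   positive integers prime to 3. *)
Lemma unitriangular_mod3_parity (b : bool) :
  unitriangular (fun k i => sympow 1 (z i) * (U i ^+ k * u i ^+ (odd k (+) b)))
    (fun k i => sympow (3 * k + 1 + (odd k (+) b)) (z i)).
Proof.
apply: (@unitriangular_rec _ _ 2 (fun i => U i ^+ 2) 2) => // [j i|[|[|[|[|//]]]] _|k i].
- by rewrite addn2 /= negbK !exprS; ring.
- by case: b; apply: (@unitriangular_of_coef _ _ _ _ [::]) => i; base.
- case: b.
    by apply: (@unitriangular_of_coef _ _ _ _ [:: 1]) => i; base.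
  by apply: (@unitriangular_of_coef _ _ _ _ [:: 1]) => i; base.
- case: b.
    by apply: (@unitriangular_of_coef _ _ _ _ [:: -1; 1]) => i; base.
  by apply: (@unitriangular_of_coef _ _ _ _ [:: -1; 1]) => i; base.
- case: b.
    by apply: (@unitriangular_of_coef _ _ _ _ [:: -1; -2; 1]) => i; base.
  by apply: (@unitriangular_of_coef _ _ _ _ [:: -1; -2; 1]) => i; base.
(* The indices k, k + 2 and k + 4 have the same parity, so the exponent grows by 6 each time, and
   U^2 - 2 = z^6 + z^-6. *)
- rewrite !addn2 /= !negbK.
  move: (nat_of_bool _) => e.
  have -> : (3 * k.+4 + 1 + e = 3 * k + 1 + e + 12)%N by lia.
  have -> : (3 * k.+2 + 1 + e = 3 * k + 1 + e + 6)%N by lia.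
  move: (3 * k + 1 + e)%N => m; rewrite /sympow /U !(exprD _ m).
  by field; rewrite expf_neq0 z0.
Qed.

End Families.
End UnitriangularFamilies.

(** * Characters of the symplectic and orthogonal groups *)

Lemma delta_mkseq (r : rat) m : Num.truncn (r + 1) = m ->
  delta r = mkseq (fun k => r - k%:R) m.
Proof. by move=> <-. Qed.

Lemma delta2_eq (r s : rat) (t : seq rat) :
  perm_eq (delta r ++ delta s) t -> sorted (fun u v => v <= u) t -> delta2 r s = t.
Proof.
have tr : transitive (fun u v : rat => v <= u) by move=> a b c ba cb; apply: le_trans ba.
move=> rst st; rewrite -[RHS](sorted_sort tr st); apply/perm_sortP => //.
  by move=> a b; apply: le_total.
by move=> a b; rewrite andbC => /le_anti.
Qed.

Lemma sorted_half_steps (r : rat) (h : nat -> nat) m : {homo h : i j / (i <= j)%N} ->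
  sorted (fun u v => v <= u) (mkseq (fun j => r - (h j)%:R) m).
Proof.
move=> hh; rewrite sorted_map; apply: (sub_sorted _ (iota_sorted 0 m)) => i j ij /=.
by rewrite lerD2l lerN2 ler_nat hh.
Qed.

Lemma delta2_same (r : rat) m : Num.truncn (r + 1) = m ->
  delta2 r r = mkseq (fun j => r - (j./2)%:R) m.*2.
Proof.
move=> /delta_mkseq dr; apply: delta2_eq; last first.
  by apply: sorted_half_steps => i j; lia.
rewrite {}dr; apply/seq.permP => p; rewrite count_cat.
elim: m => [//|m IH].
rewrite doubleS !mkseqS -!cats1 !count_cat /= -IH.
by rewrite uphalf_double doubleK; move: (count _ _) (nat_of_bool _) => a b; lia.
Qed.

(** The value r occurs once and every later value twice, whence [uphalf] and the odd length. *)
Lemma delta2_pred (r : rat) m : Num.truncn (r + 1) = m.+1 -> Num.truncn r = m ->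
  delta2 r (r - 1) = mkseq (fun j => r - (uphalf j)%:R) m.*2.+1.
Proof.
move=> /delta_mkseq dr dr'; apply: delta2_eq; last first.
  by apply: sorted_half_steps => i j; lia.
rewrite {}dr (@delta_mkseq (r - 1) m) ?subrK //; clear dr'; apply/seq.permP => p; rewrite count_cat.
elim: m => [|m IH]; first by rewrite /= !addn0.
rewrite doubleS (mkseqS _ m.+1) (mkseqS (fun k => r - 1 - k%:R) m) (mkseqS _ m.*2.+2) (mkseqS _ m.*2.+1).
rewrite -!cats1 !count_cat -IH; move: (count p (mkseq _ _)) (count p (mkseq _ _)) => a b.
rewrite /= uphalf_double doubleK.
have -> : r - 1 - m%:R = r - m.+1%:R by rewrite -natr1; ring.
by move: (nat_of_bool _) => c; lia.
Qed.

Section CharacterDeterminants.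
Variable K : fieldType.

Lemma zpow_nat (z : K) (m : nat) : zpow z m%:R = z ^+ m.
Proof. by rewrite /zpow pmulrn intrKfloor. Qed.

Lemma zpow_opp_nat (z : K) (m : nat) : zpow z (- m%:R) = z ^- m.
Proof. by rewrite /zpow pmulrn -mulrNz intrKfloor -exprnN. Qed.

(** Both determinants acquire the same sign when their columns are reversed. *)
Lemma div_det_rev N (A B : 'I_N -> 'I_N -> K) :
  \det (\matrix_(i, j) A i (rev_ord j)) / \det (\matrix_(i, j) B i (rev_ord j))
  = \det (\matrix_(i, j) A i j) / \det (\matrix_(i, j) B i j).
Proof.
have [e e0 He] := det_col_rearrange K (@rev_ord_inj N).
by rewrite !He -mulf_div divff // mul1r.
Qed.

Lemma rev_ordD N (j : 'I_N) : (rev_ord j).+1 = (N - j)%N.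
Proof. by rewrite /=; have := ltn_ord j; lia. Qed.

(** A character lists its exponents in decreasing order, the unitriangular families in increasing
    order; [m] enumerates them increasingly from index 0. *)
Lemma SpE N (lam : seq rat) (m : nat -> nat) (z : 'I_N -> K) :
  (forall j, (j < N)%N -> lam`_j + (N - j)%:R = (m (N - j.+1)%N)%:R) ->
  Sp lam z = \det (\matrix_(i < N, j < N) sympow (m j) (z i))
             / \det (\matrix_(i < N, j < N) sympow j.+1 (z i)).
Proof.
move=> lamE; rewrite -div_det_rev /Sp.
congr (_ / _); congr (\det _); apply/matrixP => i j; rewrite !mxE.
  by rewrite lamE // zpow_nat zpow_opp_nat.
by rewrite zpow_nat zpow_opp_nat -rev_ordD.
Qed.

Lemma sympow_double m (x : K) : sympow m.*2 x = sympow m (x ^+ 2).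
Proof. by rewrite /sympow -mul2n !exprM. Qed.

(** Here [m] gives exponents of x_i^2, the square root of the variable x_i^4, which makes the
    half-integers integral. *)
Lemma OtE N (lam : seq rat) (m : nat -> nat) (x : 'I_N -> K) :
  (forall j, (j < N)%N -> 2 * (lam`_j + (N - j)%:R - 1 / 2) = (m (N - j.+1)%N)%:R) ->
  Ot lam x = \det (\matrix_(i < N, j < N) sympow (m j) (x i ^+ 2))
             / \det (\matrix_(i < N, j < N) sympow j.*2.+1 (x i ^+ 2)).
Proof.
move=> lamE; rewrite -div_det_rev /Ot.
congr (_ / _); congr (\det _); apply/matrixP => i j; rewrite !mxE.
  have -> : 4 * (lam`_j + (N - j)%:R - 1 / 2) = (m (rev_ord j)).*2%:R.
    by rewrite -mul2n natrM -lamE //; ring.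
  by rewrite zpow_nat zpow_opp_nat -sympow_double.
have -> : 4 * ((N - j)%:R - 1 / 2) = (rev_ord j).*2.+1.*2%:R :> rat.
  by rewrite -rev_ordD -!mul2n !(natrM, =^~natr1); field.
by rewrite zpow_nat zpow_opp_nat -sympow_double.
Qed.

Lemma div_det_scale n (s : 'I_n -> K) (A B : 'I_n -> 'I_n -> K) : (forall i, s i != 0) ->
  \det (\matrix_(i, j) (s i * A i j)) / \det (\matrix_(i, j) (s i * B i j))
  = \det (\matrix_(i, j) A i j) / \det (\matrix_(i, j) B i j).
Proof.
move=> s0; rewrite !det_scale_rows -mulf_div divff ?mul1r //.
by apply/prodf_neq0 => i _.
Qed.

(** For this index the exponents are 1, 2, 4, 5, ..., 3n - 2, 3n - 1, the integers prime to 3. The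
    factor z - z^-1 of each row cancels in the quotient. *)
Lemma Sp_delta2 n (z : 'I_(n + n) -> K) : (0 < n)%N ->
  (forall i, z i != 0) -> (forall i, sympow 1 (z i) != 0) ->
  Sp (delta2 (n%:R - 1) (n%:R - 1)) z
  = \det (\matrix_(i, j) double_pow (fun i => z i ^+ 3 + z i ^- 3)
                                    (fun i => z i + (z i)^-1) i j)
    / \det (powmx (fun i => z i + (z i)^-1)).
Proof.
move=> n0 z0 s0; rewrite (@SpE _ _ (fun k => (k./2 + k).+1)).
  rewrite (det_unitriangular (unitriangular_mod3 z0)).
  rewrite (det_unitriangular (unitriangular_weyl z0)).
  by rewrite div_det_scale.
move=> j jn; rewrite (@delta2_same _ n); last by rewrite subrK natrK.
rewrite nth_mkseq; last by lia.
set m := _.+1; have : (m + j./2 + 1 = n + (n + n - j))%N by rewrite /m; lia.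
by move: m (n + n - j)%N => m l /(congr1 (fun k => k%:R : rat)); rewrite !natrD; lra.
Qed.

Lemma truncn_half n : Num.truncn ((n%:R - 1) / 2 + 1 : rat) = uphalf n.
Proof.
apply: truncn_def; rewrite -[(uphalf n).+1%:R]natr1.
have : n%:R = (uphalf n)%:R + (n./2)%:R :> rat by rewrite -natrD; congr _%:R; lia.
have : (n./2)%:R = (uphalf n)%:R - (odd n)%:R :> rat.
  by apply/eqP; rewrite eq_sym subr_eq -natrD; apply/eqP; congr _%:R; lia.
by case: (odd n) => /= -> ->; apply/andP; split; lra.
Qed.

Lemma truncn_half0 n : Num.truncn (n%:R / 2 : rat) = n./2.
Proof.
apply: truncn_def; rewrite -[n./2.+1%:R]natr1.
have : n%:R = (n./2)%:R + (n./2)%:R + (odd n)%:R :> rat by rewrite -!natrD; congr _%:R; lia.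
by case: (odd n) => /= ->; apply/andP; split; lra.
Qed.

Lemma truncn_half1 n : Num.truncn (n%:R / 2 + 1 : rat) = n./2.+1.
Proof.
apply: truncn_def; rewrite -[n./2.+2%:R]natr1 -[n./2.+1%:R]natr1.
have : n%:R = (n./2)%:R + (n./2)%:R + (odd n)%:R :> rat by rewrite -!natrD; congr _%:R; lia.
by case: (odd n) => /= ->; apply/andP; split; lra.
Qed.

Lemma Ot_parity n (lam : seq rat) b (x : 'I_n -> K) :
  (forall i, x i != 0) -> (forall i, sympow 1 (x i ^+ 2) != 0) ->
  (forall j, (j < n)%N -> 2 * (lam`_j + (n - j)%:R - 1 / 2)
     = (3 * (n - j.+1) + 1 + (odd (n - j.+1) (+) b))%:R) ->
  Ot lam x
  = \det (\matrix_(i, j) parity_pow b (fun i => (x i ^+ 2) ^+ 3 + (x i ^+ 2) ^- 3)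
                            (fun i => x i ^+ 2 + x i ^- 2) i j)
    / \det (powmx (fun i => (x i ^+ 2 + x i ^- 2) ^+ 2)).
Proof.
move=> x0 s0 lamE; have z0 i : x i ^+ 2 != 0 by rewrite expf_neq0.
rewrite (@OtE _ _ (fun k => 3 * k + 1 + (odd k (+) b))%N x lamE).
rewrite (det_unitriangular (unitriangular_mod3_parity z0 b)).
rewrite (det_unitriangular (unitriangular_odd z0)).
by rewrite div_det_scale.
Qed.

(** The exponents of x_i^2 are the first n positive integers that are prime to 3 and have the parity
    of n + 1. The sequence has at least n terms, so no padding occurs. *)
Lemma Ot_delta2_pred n (x : 'I_n -> K) :
  (forall i, x i != 0) -> (forall i, sympow 1 (x i ^+ 2) != 0) ->
  Ot (delta2 (n%:R / 2) (n%:R / 2 - 1)) x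
  = \det (\matrix_(i, j) parity_pow (odd n) (fun i => (x i ^+ 2) ^+ 3 + (x i ^+ 2) ^- 3)
                            (fun i => x i ^+ 2 + x i ^- 2) i j)
    / \det (powmx (fun i => (x i ^+ 2 + x i ^- 2) ^+ 2)).
Proof.
move=> x0 s0; apply: Ot_parity => // j jn.
rewrite (@delta2_pred _ n./2) ?truncn_half0 ?truncn_half1 //.
rewrite nth_mkseq; last by lia.
set m := (_ + _ + _)%N.
have : n = (j + (n - j))%N by lia.
have : (m + odd j + 1 = (n - j) + (n - j) + (n - j))%N by rewrite /m; lia.
have : (uphalf j + uphalf j = j + odd j)%N by lia.
move: m (n - j)%N (uphalf j) (nat_of_bool _) => m l h o.
have R a b : a = b -> a%:R = b%:R :> rat by move->.
move=> /R E1 /R E2 /R E3; move: E1 E2 E3; rewrite !natrD; lra.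
Qed.

(** The exponents now have the parity of n, so the two characters together use both values of the
    parity parameter. *)
Lemma Ot_delta2_same n (x : 'I_n -> K) :
  (forall i, x i != 0) -> (forall i, sympow 1 (x i ^+ 2) != 0) ->
  Ot (delta2 ((n%:R - 1) / 2) ((n%:R - 1) / 2)) x
  = \det (\matrix_(i, j) parity_pow (~~ odd n) (fun i => (x i ^+ 2) ^+ 3 + (x i ^+ 2) ^- 3)
                            (fun i => x i ^+ 2 + x i ^- 2) i j)
    / \det (powmx (fun i => (x i ^+ 2 + x i ^- 2) ^+ 2)).
Proof.
move=> x0 s0; apply: Ot_parity => // j jn.
rewrite (delta2_same (truncn_half n)).
rewrite nth_mkseq; last by lia.
set m := (_ + _ + _)%N.
have : n = (j + (n - j))%N by lia.
have : (m + 2 = (n - j) + (n - j) + (n - j) + odd j)%N by rewrite /m; lia.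
have : (j./2 + j./2 + odd j = j)%N by lia.
move: m (n - j)%N (j./2) (nat_of_bool _) => m l h o.
have R a b : a = b -> a%:R = b%:R :> rat by move->.
move=> /R E1 /R E2 /R E3; move: E1 E2 E3; rewrite !natrD; lra.
Qed.
End CharacterDeterminants.

(** * Reduction to a quadratic form *)

Section QuadraticForm.
Variable K : fieldType.

Definition quad (c u v : K) : K := u ^+ 2 + v ^+ 2 - c * u * v + c ^+ 2 - 4.

Definition csum (x : K) : K := x ^+ 2 + x ^- 2.

(** Lets the sign of c - 2 be dropped from its power n(n - 1). *)
Lemma oddM_pred n : odd (n * n.-1) = false.
Proof. by case: n => // n; rewrite oddM /= andNb. Qed.

(** The exponent is even, and the square of [sigma a] is c - 2. *)
Lemma expr_double_pred (a : K) n :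
  a ^ (- (2 * n%:Z ^+ 2) + 2 * n%:Z) = ((a ^+ 2) ^+ (n * n.-1))^-1.
Proof.
rewrite -exprM exprnN; congr (_ ^ _); case: n => // n.
by rewrite !PoszM /= -addn1 PoszD; ring.
Qed.

Lemma expr_pred (a : K) n : a ^ (- (n%:Z * (n%:Z - 1))) = (a ^+ (n * n.-1))^-1.
Proof.
rewrite exprnN; congr (_ ^ _); case: n => // n.
by rewrite !PoszM /= -addn1 PoszD; ring.
Qed.

Lemma addV_neq (p q : K) : p != 0 -> q != 0 -> p != q -> p * q != 1 ->
  p + p^-1 != q + q^-1.
Proof.
move=> p0 q0 pq pq1; rewrite -subr_eq0.
have -> : p + p^-1 - (q + q^-1) = (p - q) * (p * q - 1) / (p * q).
  by field; rewrite p0 q0.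
by rewrite !mulf_neq0 ?invr_eq0 ?mulf_neq0 ?subr_eq0.
Qed.

Lemma addV_add_neq0 (p q : K) : p != 0 -> q != 0 -> p != - q -> p * q != -1 ->
  p + p^-1 + (q + q^-1) != 0.
Proof.
move=> p0 q0 pq pq1.
have -> : p + p^-1 + (q + q^-1) = (p + q) * (p * q + 1) / (p * q).
  by field; rewrite p0 q0.
by rewrite !mulf_neq0 ?invr_eq0 ?mulf_neq0 ?addr_eq0.
Qed.

(** For c = d + d^-1 the form splits into four factors, one for each of the last four hypotheses. *)
Lemma quad_neq0 (d p q : K) : d != 0 -> p != 0 -> q != 0 ->
  p != d * q -> p != d^-1 * q -> p * q != d -> p * q != d^-1 ->
  quad (d + d^-1) (p + p^-1) (q + q^-1) != 0.
Proof.
move=> d0 p0 q0 r1 r2 p1 p2.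
have -> : quad (d + d^-1) (p + p^-1) (q + q^-1)
  = (p - d * q) * (p - d^-1 * q) * ((p * q - d) * (p * q - d^-1)) / (p * q) ^+ 2.
  by rewrite /quad; field; rewrite p0 q0 d0.
by rewrite !mulf_neq0 ?invr_eq0 ?expf_neq0 ?mulf_neq0 ?subr_eq0.
Qed.

Lemma sympow1_neq0 (x : K) : x != 0 -> x ^+ 4 != 1 -> sympow 1 (x ^+ 2) != 0.
Proof.
move=> x0 x4; rewrite (_ : sympow 1 _ = (x ^+ 4 - 1) / x ^+ 2).
  by rewrite mulf_neq0 ?invr_eq0 ?expf_neq0 // subr_eq0.
by rewrite /sympow; field.
Qed.

Section Reduction.
Variables (n : nat) (x y : 'I_n -> K) (a c : K).
Hypotheses (x0 : forall i, x i != 0) (y0 : forall i, y i != 0) (a0 : a != 0).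
Hypotheses (x4 : forall i, x i ^+ 4 != 1) (y4 : forall i, y i ^+ 4 != 1).
Hypothesis ca : a ^+ 2 + a ^- 2 = c.
Let u i := csum (x i).
Let v i := csum (y i).
Hypothesis D0 : forall i j, quad c (u i) (v j) != 0.

Let P i j := sigma (a * x i / y j) * sigma (a * y j / x i).
Let Q i j := sigma (a * x i * y j) * sigma (a / (x i * y j)).

(** Put s = x^2/y^2 + y^2/x^2 and t = x^2 y^2 + x^-2 y^-2. Then P = c - s and Q = c - t, while s + t
    = u v and s t = u^2 + v^2 - 4. *)
Lemma sigma_quad i j : P i j * Q i j = quad c (u i) (v j).
Proof.
rewrite /P /Q /sigma /quad /u /v /csum -ca; field.
by rewrite x0 y0 a0.
Qed.

(** The numerator Q - P of the combined fraction is -(x^2 - x^-2)(y^2 - y^-2), which splits into a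
    row factor and a column factor. *)
Lemma MU_quad i j : MU x y a i j
  = - sympow 1 (x i ^+ 2) * (sympow 1 (y j ^+ 2) * (1 / quad c (u i) (v j))).
Proof.
have := D0 i j; rewrite -sigma_quad mulf_eq0 negb_or => /andP[P0 Q0].
rewrite mxE -/(P i j) -/(Q i j).
have -> : 1 / P i j - 1 / Q i j = (Q i j - P i j) / (P i j * Q i j).
  by field; rewrite P0 Q0.
rewrite mul1r !mulrA; congr (_ / _).
rewrite /P /Q /sigma /sympow; field.
by rewrite x0 y0 a0.
Qed.

(** The row and column factors of the determinant cancel against the diagonal terms i = j in the
    denominator of [FV]. For i < j the four sigmas combine into (u_i - u_j)(v_i - v_j). *)
Lemma AV_quad :
  AV x y a = ((c - 2) ^+ (n * n.-1))^-1
   * ((\prod_i \prod_j quad c (u i) (v j))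
      * \det (\matrix_(i, j) (1 / quad c (u i) (v j))))
   / \prod_(i < n) \prod_(j < n | (i < j)%N) ((u i - u j) * (v i - v j)).
Proof.
have sE i : sigma (1 / (x i * x i)) * sigma (y i * y i)
    = - sympow 1 (x i ^+ 2) * sympow 1 (y i ^+ 2).
  by rewrite /sigma /sympow; field; rewrite x0 y0 oner_neq0.
have uvE i j : sigma (x j / x i) * sigma (y i / y j)
    * (sigma (1 / (x i * x j)) * sigma (y i * y j)) = (u i - u j) * (v i - v j).
  by rewrite /sigma /u /v /csum; field; rewrite !x0 !y0 ?oner_neq0.
rewrite /AV expr_double_pred (_ : sigma a ^+ 2 = c - 2); last first.
  by rewrite /sigma -ca; field.
have -> : MU x y a = \matrix_(i, j) (- sympow 1 (x i ^+ 2)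
   * (sympow 1 (y j ^+ 2) * (1 / quad c (u i) (v j)))).
  by apply/matrixP => i j; rewrite MU_quad mxE.
rewrite det_scale_rows det_scale_cols /FV.
have -> : \prod_(i < n) \prod_(j < n) (sigma (a * x i / y j) * sigma (a * y j / x i)
    * sigma (a * x i * y j) * sigma (a / (x i * y j)))
    = \prod_i \prod_j quad c (u i) (v j).
  apply: eq_bigr => i _; apply: eq_bigr => j _.
  by rewrite -sigma_quad /P /Q !mulrA.
set A := \prod_i \prod_j _; set B := \det _.
set X := \prod_i - _; set Y := \prod_i sympow _ _.
set Z := \prod_(i < n) \prod_(j < n | _) ((u i - u j) * _).
have X0 : X != 0 by apply/prodf_neq0 => i _; rewrite oppr_eq0 sympow1_neq0.
have Y0 : Y != 0 by apply/prodf_neq0 => i _; rewrite sympow1_neq0.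
have -> : (\prod_(i < n) \prod_(j < n | (i < j)%N)
        (sigma (x j / x i) * sigma (y i / y j)))
     * (\prod_(i < n) \prod_(j < n | (i <= j)%N)
          (sigma (1 / (x i * x j)) * sigma (y i * y j))) = X * Y * Z.
  rewrite /X /Y /Z -!big_split; apply: eq_bigr => i _ /=.
  rewrite [X in _ * X](bigD1 i) //= mulrCA; congr (_ * _); first exact: sE.
  rewrite [X in _ * X](eq_bigl (fun j : 'I_n => (i < j)%N)); last first.
    by move=> j; rewrite -val_eqE /=; case: ltngtP.
  by rewrite -big_split; apply: eq_bigr => j _; apply: uvE.
rewrite !invfM; set N := _ ^- _.
transitivity (N * (A * B) * (X / X) * (Y / Y) / Z); first by ring.
by rewrite !mulfV // !mulr1.
Qed.

End Reduction.

(** * Evaluation for c = -2 *)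

Lemma csum_add (x y : K) : x != 0 -> y != 0 ->
  csum x + csum y = x ^- 2 * (y ^- 2 * ((x ^+ 2 + y ^+ 2) * (1 + x ^+ 2 * y ^+ 2))).
Proof. by move=> x0 y0; rewrite /csum; field; rewrite x0 y0. Qed.

Lemma permanent_scale n (s t : 'I_n -> K) (A : 'I_n -> 'I_n -> K) :
  permanent (\matrix_(i, j) (s i * (t j * A i j)))
  = (\prod_i s i) * (\prod_i t i) * permanent (\matrix_(i, j) A i j).
Proof.
rewrite /permanent mulr_sumr; apply: eq_bigr => p _.
rewrite [LHS](eq_bigr (fun i => s i * (t (p i) * A i (p i)))) => [|i _]; last by rewrite mxE.
rewrite !big_split /= mulrA [\prod_i t i](reindex_inj (@perm_inj _ p)).
by congr (_ * _); apply: eq_bigr => i _; rewrite mxE.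
Qed.

Lemma expr_double_opp (x : K) n : x != 0 -> (0 < n)%N ->
  x ^ (- (2 * n%:Z) + 2) = (x ^- 2) ^+ n.-1.
Proof.
move=> x0; case: n => // n _; rewrite /= exprVn -exprM exprnN; congr (_ ^ _).
by rewrite PoszM -addn1 PoszD; ring.
Qed.

Lemma AV_borchardt n (x y : 'I_n -> K) (a : K) : (0 < n)%N ->
  (forall i, x i != 0) -> (forall i, y i != 0) -> a != 0 ->
  (forall i, x i ^+ 4 != 1) -> (forall i, y i ^+ 4 != 1) ->
  a ^+ 2 + a ^- 2 = -2 ->
  (forall i j, csum (x i) + csum (y j) != 0) ->
  injective (csum \o x) -> injective (csum \o y) ->
  AV x y a =
    2 ^ (- (2 * n%:Z ^+ 2) + 2 * n%:Z)
    * \prod_(i < n) (x i ^ (- (2 * n%:Z) + 2) * y i ^ (- (2 * n%:Z) + 2))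
    * \prod_(i < n) \prod_(j < n)
        ((x i ^+ 2 + y j ^+ 2) * (1 + x i ^+ 2 * y j ^+ 2))
    * permanent (\matrix_(i < n, j < n)
        (1 / ((x i ^+ 2 + y j ^+ 2) * (1 + x i ^+ 2 * y j ^+ 2)))).
Proof.
move=> n0 x0 y0 a0 x4 y4 ca uv injx injy.
have qE i j : quad (-2) (csum (x i)) (csum (y j)) = (csum (x i) + csum (y j)) ^+ 2.
  by rewrite /quad; ring.
rewrite (AV_quad x0 y0 a0 x4 y4 ca) => [|i j]; last by rewrite qE expf_neq0.
rewrite expr_double_pred (_ : (-2 - 2) ^+ _ = (2 ^+ 2) ^+ (n * n.-1)); last first.
  have -> : -2 - 2 = - 2 ^+ 2 :> K by ring.
  by rewrite exprNn -signr_odd oddM_pred expr0 mul1r.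
rewrite -!mulrA; congr (_ * _).
have -> : \matrix_(i, j) (1 / quad (-2) (csum (x i)) (csum (y j)))
  = \matrix_(i, j) (1 / (csum (x i) - - csum (y j)) ^+ 2).
  by apply/matrixP => i j; rewrite !mxE qE opprK.
rewrite (@borchardt _ _ (csum \o x) (fun j => - csum (y j))) //; last first.
  by move=> i j /=; rewrite opprK.
have -> : \matrix_(i, j) (1 / ((csum \o x) i - - csum (y j)))
  = \matrix_(i, j) (1 / ((csum \o x) i + (csum \o y) j)).
  by apply/matrixP => i j; rewrite !mxE opprK.
have -> : \prod_i \prod_j quad (-2) (csum (x i)) (csum (y j))
  = (\prod_i \prod_j ((csum \o x) i + (csum \o y) j))
    * (\prod_i \prod_j (csum (x i) + csum (y j))).
  rewrite -big_split; apply: eq_bigr => i _; rewrite -big_split.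
  by apply: eq_bigr => j _; rewrite qE expr2.
set p := permanent _; set S := \prod_i \prod_j (csum (x i) + _).
set d := \det _; set Z := \prod_(i < n) \prod_(j < n | _) _.
(* One of the two products of sums turns the Cauchy determinant into Z, which cancels the
   denominator; the other stays with the permanent. *)
have Sd : S * d = Z := cauchy_det_add injy uv.
rewrite [LHS](_ : _ = S * d / Z * (S * p)); last by ring.
rewrite Sd mulfV ?mul1r; last first.
  apply/prodf_neq0 => i _; apply/prodf_neq0 => j ij.
  by rewrite mulf_neq0 // subr_eq0; apply: contraTneq ij;
   [move=> /injx->|move=> /injy->]; rewrite ltnn.
rewrite /p (_ : \matrix_(i, j) _ = \matrix_(i, j) (x i ^+ 2 * (y j ^+ 2
   * (1 / ((x i ^+ 2 + y j ^+ 2) * (1 + x i ^+ 2 * y j ^+ 2)))))); last first.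
  apply/matrixP => i j; rewrite !mxE /= csum_add // !invfM !invrK; ring.
rewrite permanent_scale /S.
have -> : \prod_i \prod_j (csum (x i) + csum (y j)) =
  (\prod_i (x i ^- 2) ^+ n) * (\prod_i (y i ^- 2) ^+ n)
   * \prod_i \prod_j ((x i ^+ 2 + y j ^+ 2) * (1 + x i ^+ 2 * y j ^+ 2)).
  under eq_bigr do under eq_bigr do rewrite csum_add //.
  under eq_bigr do rewrite big_split /= big_const_ord iter_mulr_1 big_split /=.
  rewrite !big_split /= big_const_ord iter_mulr_1 mulrA.
  by rewrite !prodrXl.
rewrite [RHS](_ : _ = (\prod_(i < n) (x i ^ (- (2 * n%:Z) + 2) * y i ^ (- (2 * n%:Z) + 2)))
  * (\prod_i \prod_j ((x i ^+ 2 + y j ^+ 2) * (1 + x i ^+ 2 * y j ^+ 2)) * permanent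
     (\matrix_(i, j) (1 / ((x i ^+ 2 + y j ^+ 2) * (1 + x i ^+ 2 * y j ^+ 2)))))) //.
(* The remaining product contributes x_i^(-2n) and the permanent x_i^2, and likewise for y. *)
rewrite (_ : \prod_(i < n) (x i ^ (- (2 * n%:Z) + 2) * y i ^ (- (2 * n%:Z) + 2)) = (\prod_i (x i ^- 2) ^+ n) * (\prod_i (y i ^- 2) ^+ n)
   * ((\prod_i x i ^+ 2) * \prod_i y i ^+ 2)); first by ring.
rewrite -!big_split; apply: eq_bigr => i _ /=.
rewrite !expr_double_opp //; case: (n) n0 => // m _; rewrite !exprS /=.
by field; rewrite x0 y0.
Qed.
End QuadraticForm.

(** * Evaluation for c = 0, -1 and 1 *)

Section Specialisations.
Variable K : fieldType.

Local Notation csum := (@csum K).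
Definition csum3 (x : K) : K := x ^+ 6 + x ^- 6.

(** Each index lies in n - 1 unordered pairs. *)
Lemma prod_const_pred n (F : 'I_n -> K) :
  \prod_(i < n) \prod_(j < n | (i < j)%N) (F i * F j) = \prod_i F i ^+ n.-1.
Proof.
rewrite -(prod_ltn_gtn (fun i _ => F i)); apply: eq_bigr => i _.
rewrite prodr_const; congr (_ ^+ _).
by have := cardC1 i; rewrite card_ord => <-; apply: eq_card => j; rewrite !inE.
Qed.

Lemma prod_ltn_neq0 n (f : 'I_n -> 'I_n -> K) : (forall i j, i != j -> f i j != 0) ->
  \prod_(i < n) \prod_(j < n | (i < j)%N) f i j != 0.
Proof.
move=> f0; apply/prodf_neq0 => i _; apply/prodf_neq0 => j ij.
by apply: f0; rewrite -val_eqE ltn_eqF.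
Qed.

Lemma AV_cauchy n (x y : 'I_n -> K) (a : K) : (0 < n)%N ->
  (forall i, x i != 0) -> (forall i, y i != 0) -> a != 0 ->
  (forall i, x i ^+ 4 != 1) -> (forall i, y i ^+ 4 != 1) ->
  a ^+ 2 + a ^- 2 = 0 ->
  (forall i j, quad 0 (csum (x i)) (csum (y j)) != 0) ->
  injective (csum \o x) -> injective (csum \o y) ->
  (forall i j, i != j -> csum (y i) + csum (y j) != 0) ->
  AV x y a =
    2 ^ (- (n%:Z * (n%:Z - 1)))
    * \prod_(i < n) (x i ^ (- (2 * n%:Z) + 2) * y i ^ (- (2 * n%:Z) + 2))
    * \prod_(i < n) \prod_(j < n | (i < j)%N)
        ((x i ^+ 2 + x j ^+ 2) * (1 + x i ^+ 2 * x j ^+ 2)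
         * (y i ^+ 2 + y j ^+ 2) * (1 + y i ^+ 2 * y j ^+ 2)).
Proof.
move=> n0 x0 y0 a0 x4 y4 ca D0 injx injy yy.
rewrite (AV_quad x0 y0 a0 x4 y4 ca) // sub0r exprNn -signr_odd oddM_pred expr0 mul1r expr_pred.
rewrite -!mulrA; congr (_ * _).
pose X i := csum (x i) ^+ 2 - 4; pose Y j := csum (y j) ^+ 2.
have qE i j : quad 0 (csum (x i)) (csum (y j)) = X i + Y j by rewrite /quad /X /Y; ring.
have injY : injective Y.
  move=> i j /eqP; rewrite -subr_eq0 subr_sqr mulf_eq0 subr_eq0.
  have [-> //|/yy /negPf ->] := eqVneq i j.
  by rewrite orbF => /eqP /injy.
rewrite [X in X * _](_ : _ = \prod_i \prod_j (X i + Y j)); last first.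
  by apply: eq_bigr => i _; apply: eq_bigr => j _.
have -> : \matrix_(i, j) (1 / quad 0 (csum (x i)) (csum (y j))) = \matrix_(i, j) (1 / (X i + Y j)).
  by apply/matrixP => i j; rewrite !mxE qE.
rewrite mulrA cauchy_det_add //; last by move=> i j; rewrite -qE.
pose W i j := (x i ^+ 2 + x j ^+ 2) * (1 + x i ^+ 2 * x j ^+ 2)
         * (y i ^+ 2 + y j ^+ 2) * (1 + y i ^+ 2 * y j ^+ 2).
(* Each difference of squares contains a difference that the denominator cancels; the sums that
   remain give the stated product. *)
have -> : \prod_(i < n) \prod_(j < n | (i < j)%N) ((X i - X j) * (Y i - Y j))
  = (\prod_(i < n) \prod_(j < n | (i < j)%N)
      ((csum (x i) - csum (x j)) * (csum (y i) - csum (y j))))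
    * (\prod_(i < n) \prod_(j < n | (i < j)%N)
       (x i ^- 2 * y i ^- 2 * (x j ^- 2 * y j ^- 2)))
    * \prod_(i < n) \prod_(j < n | (i < j)%N) W i j.
  rewrite -!big_split; apply: eq_bigr => i _; rewrite -!big_split; apply: eq_bigr => j _ /=.
  rewrite /X /Y /W.
  have -> : csum (x i) ^+ 2 - 4 - (csum (x j) ^+ 2 - 4)
    = (csum (x i) - csum (x j)) * (csum (x i) + csum (x j)) by ring.
  by rewrite subr_sqr !csum_add //; ring.
set Z := \prod_(i < n) \prod_(j < n | _) ((csum (x i) - _) * _).
have Z0 : Z != 0.
  apply: prod_ltn_neq0 => i j ij.
  by rewrite mulf_neq0 // subr_eq0 ?(inj_eq injx) ?(inj_eq injy).
rewrite -(mulrA Z) [Z * _]mulrC mulfK //.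
rewrite (prod_const_pred (fun i => x i ^- 2 * y i ^- 2)).
congr (_ * _); apply: eq_bigr => i _; first by rewrite !expr_double_opp // exprMn.
Qed.

Lemma joinvP n (P : K -> Prop) (x y : 'I_n -> K) :
  (forall i, P (x i)) -> (forall i, P (y i)) -> forall k, P (joinv x y k).
Proof. by move=> Px Py k; rewrite /joinv; case: split. Qed.

Lemma AV_symplectic n (x y : 'I_n -> K) (a : K) : (0 < n)%N ->
  (forall i, x i != 0) -> (forall i, y i != 0) -> a != 0 ->
  (forall i, x i ^+ 4 != 1) -> (forall i, y i ^+ 4 != 1) ->
  a ^+ 2 + a ^- 2 = -1 ->
  (forall i j, quad (-1) (csum (x i)) (csum (y j)) != 0) ->
  injective (csum \o x) -> injective (csum \o y) -> injective (csum3 \o y) ->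
  (forall i j, i != j -> csum (y i) + csum (y j) != 0) ->
  (forall i j, csum (x i) + csum (y j) != 0) ->
  (forall i j, csum (x i) - csum (y j) != 0) ->
  AV x y a =
    3 ^ (- (n%:Z * (n%:Z - 1)))
    * Sp (delta2 (n%:R - 1) (n%:R - 1))
        (joinv (fun i => x i ^+ 2) (fun i => y i ^+ 2)).
Proof.
move=> n0 x0 y0 a0 x4 y4 ca D0 injx injy injy3 yy xy xy'.
rewrite (AV_quad x0 y0 a0 x4 y4 ca) // (_ : -1 - 2 = -3); last by ring.
rewrite exprNn -signr_odd oddM_pred expr0 mul1r expr_pred.
rewrite -!mulrA; congr (_ * _).
set z := joinv _ _.
have z0 : forall i, z i != 0.
  by apply: (joinvP (P := fun t => t != 0)) => i; rewrite expf_neq0.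
have s0 : forall i, sympow 1 (z i) != 0.
  by apply: (joinvP (P := fun t => sympow 1 t != 0)) => i; rewrite sympow1_neq0.
rewrite Sp_delta2 //.
pose U := csum3 \o x; pose V := csum3 \o y; pose u := csum \o x; pose v := csum \o y.
have [e e0 He] := det_double_pow K n.
have UV i j : U i - V j = quad (-1) (u i) (v j) * (u i - v j).
  by rewrite /U /V /u /v /= /csum3 /quad /csum; field; rewrite x0 y0.
have UV0 i j : U i - V j != 0 by rewrite UV mulf_neq0 ?D0 ?xy'.
have -> : \matrix_(i, j) double_pow (fun i => z i ^+ 3 + z i ^- 3)
    (fun i => z i + (z i)^-1) i j
  = \matrix_(i, j) double_pow (joinv U V) (joinv u v) i j.
  apply/matrixP => i j; rewrite !mxE /double_pow /z /joinv.
  by case: split => k; rewrite -!exprM.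
(* A Vandermonde matrix in u, v is itself interleaved, with X = u^2 and a = u. Numerator and
   denominator thus fall under the same [det_double_pow]. *)
have -> : powmx (fun i => z i + (z i)^-1)
  = \matrix_(i, j) double_pow (joinv (fun i => u i ^+ 2) (fun i => v i ^+ 2)) (joinv u v) i j.
  apply/matrixP => i j; rewrite !mxE /double_pow /z /joinv.
  case: split => k; rewrite -exprM -exprD; congr (_ ^+ _);
  by rewrite mul2n addnC odd_double_half.
have sq i j : u i ^+ 2 - v j ^+ 2 = (u i - v j) * (u i + v j) by rewrite subr_sqr.
rewrite !He //; first last.
- by move=> i j; rewrite sq mulf_neq0 ?xy ?xy'.
- move=> i j /eqP; rewrite -subr_eq0 subr_sqr mulf_eq0 subr_eq0.
  have [-> //|/yy /negPf yyF] := eqVneq i j.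
  by rewrite /v /= yyF orbF => /eqP /injy.
set d1 := \det _; set d2 := \det _; set d3 := \det _.
have -> : d1 = d2.
  congr (\det _); apply/matrixP => i j; rewrite !mxE UV -[quad _ (csum _) _]/(quad (-1) (u i) (v j)).
  by field; rewrite xy' D0.
have -> : \prod_i \prod_j quad (-1) (csum (x i)) (csum (y j)) =
  (\prod_i \prod_j (U i - V j)) / \prod_i \prod_j (u i - v j).
  rewrite -prodf_div; apply: eq_bigr => i _; rewrite -prodf_div; apply: eq_bigr => j _.
  by rewrite UV mulfK ?xy'.
(* In the denominator (u - v) / (u^2 - v^2) = 1 / (u + v), again a Cauchy matrix. *)
have d3E : d3 = \det (\matrix_(i, j) (1 / (u i + v j))).
  congr (\det _); apply/matrixP => i j; rewrite !mxE sq.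
  by field; rewrite xy xy'.
have -> : \prod_i \prod_j (u i ^+ 2 - v j ^+ 2) =
   (\prod_i \prod_j (u i - v j)) * (\prod_i \prod_j (u i + v j)).
  rewrite -big_split; apply: eq_bigr => i _; rewrite -big_split; apply: eq_bigr => j _.
  by rewrite sq.
have := cauchy_det_add injy xy; rewrite -/u -/v -d3E => cE.
rewrite -[in RHS](mulrA _ _ d3) cE.
set Z := \prod_(i < n) \prod_(j < n | _) _.
have Z0 : Z != 0.
  apply: prod_ltn_neq0 => i j ij.
  by rewrite mulf_neq0 // subr_eq0 ?(inj_eq injx) ?(inj_eq injy).
set M := \prod_i \prod_j (u i - v j).
have M0 : M != 0 by apply/prodf_neq0 => i _; apply/prodf_neq0 => j _; exact: xy'.
by field; rewrite Z0 M0 e0.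
Qed.

Lemma AV_orthogonal n (x : 'I_n -> K) (a : K) : (0 < n)%N ->
  (forall i, x i != 0) -> a != 0 ->
  (forall i, x i ^+ 4 != 1) ->
  a ^+ 2 + a ^- 2 = 1 ->
  (forall i j, quad 1 (csum (x i)) (csum (x j)) != 0) ->
  injective (csum \o x) -> injective (csum3 \o x) ->
  (forall i j, csum (x i) + csum (x j) != 0) ->
  AV x x a =
    1 / (\prod_(i < n) (x i ^+ 2 + x i ^- 2))
    * Ot (delta2 (n%:R / 2) (n%:R / 2 - 1)) x
    * Ot (delta2 ((n%:R - 1) / 2) ((n%:R - 1) / 2)) x.
Proof.
move=> n0 x0 a0 x4 ca D0 injx injx3 xx.
rewrite (AV_quad x0 x0 a0 x4 x4 ca) // (_ : 1 - 2 = -1); last by ring.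
rewrite -signr_odd oddM_pred expr0 invr1 mul1r.
have s0 i : sympow 1 (x i ^+ 2) != 0 by rewrite sympow1_neq0.
rewrite Ot_delta2_pred // Ot_delta2_same //.
pose U := csum3 \o x; pose u := csum \o x.
have UE b : \matrix_(i, j) parity_pow b (fun i => (x i ^+ 2) ^+ 3 + (x i ^+ 2) ^- 3)
      (fun i => x i ^+ 2 + x i ^- 2) i j = \matrix_(i, j) parity_pow b U u i j.
  by apply/matrixP => i j; rewrite !mxE /parity_pow -!exprM.
rewrite !UE.
set W := \det (powmx _).
have UU i j : U i + U j = quad 1 (u i) (u j) * (u i + u j).
  by rewrite /U /u /= /csum3 /quad /csum; field; rewrite !x0.
have UU0 i j : U i + U j != 0 by rewrite UU mulf_neq0 ?D0 ?xx.
have -> : \matrix_(i, j) (1 / quad 1 (csum (x i)) (csum (x j)))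
  = \matrix_(i, j) ((u i + u j) / (U i + U j)).
  apply/matrixP => i j; rewrite !mxE UU -[quad _ (csum _) _]/(quad 1 (u i) (u j)).
  by field; rewrite xx D0.
have -> : \prod_i \prod_j quad 1 (csum (x i)) (csum (x j)) =
  (\prod_i \prod_j (U i + U j)) / \prod_i \prod_j (u i + u j).
  rewrite -prodf_div; apply: eq_bigr => i _; rewrite -prodf_div; apply: eq_bigr => j _.
  by rewrite UU mulfK ?xx.
have injU : injective U := injx3.
rewrite [_ / _ * \det _]mulrAC (det_add_quotient u injU UU0).
set d0 := \det (\matrix_(i, j) parity_pow false _ _ _ _).
set d1 := \det (\matrix_(i, j) parity_pow true _ _ _ _).
rewrite -!mulrA.
(* The parity of n only decides which character carries which determinant. *)
have -> : \det (\matrix_(i, j) parity_pow (odd n) U u i j) * (W^-1 *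
  (\det (\matrix_(i, j) parity_pow (~~ odd n) U u i j) / W)) = d0 * d1 / (W * W).
  by rewrite invfM /d0 /d1; case: (odd n) => /=; ring.
(* The diagonal terms 2 u_i supply the power of 2 that cancels the one from [det_add_quotient], and
   the prefactor of the formula. *)
have -> : \prod_i \prod_j (u i + u j) = 2 ^+ n * (\prod_i u i)
  * \prod_(i < n) \prod_(j < n | (i < j)%N) ((u i + u j) * (u j + u i)).
  rewrite -(prod_ltn_gtn (fun i j => u i + u j)).
  rewrite -[n in 2 ^+ n]card_ord -prodr_const -!big_split; apply: eq_bigr => i _ /=.
  by rewrite (bigD1 i) //=; congr (_ * _); ring.
set Z := \prod_(i < n) \prod_(j < n | (i < j)%N) _.
set T := \prod_(i < n) \prod_(j < n | (i < j)%N) _.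
have WE : W * W = Z * T.
  rewrite /W det_powmx -!big_split; apply: eq_bigr => i _ /=.
  rewrite -!big_split; apply: eq_bigr => j _ /=; rewrite /u /= /csum; ring.
have Z0 : Z != 0.
  by apply: prod_ltn_neq0 => i j _; apply: mulf_neq0; apply: xx.
have T0 : T != 0.
  by apply: prod_ltn_neq0 => i j ij; rewrite mulf_neq0 // subr_eq0 (inj_eq injx).
have u0 i : u i != 0.
  by apply: contraNneq (xx i i) => /= ui; rewrite -[csum _]/(u i) ui addr0.
(* Since n > 0 there is an index i, and u_i + u_i != 0 excludes characteristic 2. *)
have two0 : 2 != 0 :> K.
  have i0 := Ordinal n0; apply: contraNneq (xx i0 i0) => t.
  by rewrite -mulr2n -mulr_natl t mul0r.
have p0 : \prod_i u i != 0 by apply/prodf_neq0 => i _.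
rewrite WE -[\prod_i (_ + _)]/(\prod_i u i).
have t0 := expf_neq0 n two0; move: (2 ^+ n) t0 => t t0.
by field; rewrite T0 Z0 p0 t0.
Qed.
End Specialisations.

(** * Roots of unity and rational functions *)

Section Zeta.
Variable R : realType.

Lemma zetaE m : (0 < m)%N ->
  zeta R m = (cos (pi *+ 2 / m%:R) +i* sin (pi *+ 2 / m%:R))%C.
Proof.
move=> m0; have -> : zeta R m = cexp ((0 : R) +i* (pi *+ 2 / m%:R))%C.
  congr cexp; have -> : (m%:R : R[i]) = (m%:R)%:C%C by rewrite rmorph_nat.
  by rewrite -fmorphV /=; apply/eqP; rewrite eq_complex /=; apply/andP; split; apply/eqP; ring.
by rewrite /cexp /= expR0 !mul1r.
Qed.

Lemma cos_sin_exp (t : R) k :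
  ((cos t +i* sin t) ^+ k)%C = (cos (t *+ k) +i* sin (t *+ k))%C.
Proof.
elim: k => [|k IH]; first by rewrite expr0 mulr0n cos0 sin0.
rewrite exprS IH mulrS cosD sinD; apply/eqP; rewrite eq_complex /=.
by apply/andP; split; apply/eqP; ring.
Qed.

Lemma zeta_exp_half m : (0 < m)%N -> zeta R (m + m) ^+ m = -1.
Proof.
move=> m0; rewrite zetaE ?addn_gt0 ?m0 // cos_sin_exp.
have -> : (pi *+ 2 / (m + m)%:R) *+ m = pi :> R.
  rewrite -[_ *+ m]mulr_natr natrD; field.
  by rewrite -natrD pnatr_eq0; lia.
by rewrite cospi sinpi; apply/eqP; rewrite eq_complex /= oppr0 !eqxx.
Qed.

(** The angle lies strictly between 0 and pi, so the imaginary part is positive. *)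
Lemma zeta_neq_N1 m : (2 < m)%N -> zeta R m != -1.
Proof.
move=> m2; rewrite zetaE; last by lia.
rewrite eq_complex /= oppr0 negb_and; apply/orP; right.
rewrite gt_eqF // sin_gt0_pi //; apply/andP; split.
  by apply: divr_gt0; [rewrite pmulrn_rgt0 ?pi_gt0 | rewrite ltr0n; lia].
rewrite ltr_pdivrMr ?ltr0n; last by lia.
by rewrite -[pi *+ 2]mulr_natr ltr_pM2l ?pi_gt0 // ltr_nat.
Qed.

Lemma zeta_neq0 m : (0 < m)%N -> zeta R (m + m) != 0.
Proof.
move=> m0; apply/eqP => z0; have := zeta_exp_half m0.
by rewrite z0 expr0n gtn_eqF // => /eqP; rewrite eq_sym oppr_eq0 oner_eq0.
Qed.

Lemma zeta12_sqr : zeta R 12 ^+ 2 = zeta R 6.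
Proof.
rewrite !zetaE // cos_sin_exp.
by have -> : (pi *+ 2 / 12%:R) *+ 2 = pi *+ 2 / 6%:R :> R by field.
Qed.

(** Factor z^3 + 1 = (z + 1)(z^2 - z + 1), where the first factor is nonzero. *)
Lemma zeta6_quadratic : zeta R 6 ^+ 2 - zeta R 6 + 1 = 0.
Proof.
have z3 : zeta R 6 ^+ 3 = -1 := @zeta_exp_half 3 isT.
have : (zeta R 6 + 1) * (zeta R 6 ^+ 2 - zeta R 6 + 1) = 0.
  by rewrite -[RHS](subrr (-1)) -{1}z3; ring.
move/eqP; rewrite mulf_eq0 addr_eq0 (negPf (zeta_neq_N1 _)) //=.
by move/eqP.
Qed.

Lemma zeta4_sum : zeta R 4 ^+ 2 + zeta R 4 ^- 2 = -2.
Proof.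
have -> : zeta R 4 ^+ 2 = -1 := @zeta_exp_half 2 isT.
by field.
Qed.

Lemma zeta8_sum : zeta R 8 ^+ 2 + zeta R 8 ^- 2 = 0.
Proof.
have z0 : zeta R 8 != 0 := @zeta_neq0 4 isT.
have z4 : zeta R 8 ^+ 4 = -1 := @zeta_exp_half 4 isT.
have -> : zeta R 8 ^+ 2 + zeta R 8 ^- 2 = (zeta R 8 ^+ 4 + 1) / zeta R 8 ^+ 2 by field.
by rewrite z4 addNr mul0r.
Qed.

Lemma zeta6_sum : zeta R 6 ^+ 2 + zeta R 6 ^- 2 = -1.
Proof.
have z0 : zeta R 6 != 0 := @zeta_neq0 3 isT.
have q := zeta6_quadratic.
have : zeta R 6 ^+ 2 + zeta R 6 ^- 2 + 1
  = (zeta R 6 ^+ 2 - zeta R 6 + 1) * (zeta R 6 ^+ 2 + zeta R 6 + 1) / zeta R 6 ^+ 2 by field.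
by rewrite q !mul0r => /eqP; rewrite addr_eq0 => /eqP.
Qed.

Lemma zeta12_sum : zeta R 12 ^+ 2 + zeta R 12 ^- 2 = 1.
Proof.
rewrite zeta12_sqr.
have z0 : zeta R 6 != 0 := @zeta_neq0 3 isT.
have : zeta R 6 + (zeta R 6)^-1 - 1 = (zeta R 6 ^+ 2 - zeta R 6 + 1) / zeta R 6 by field.
by rewrite zeta6_quadratic mul0r => /eqP; rewrite subr_eq0 => /eqP.
Qed.

End Zeta.

Section RationalFunctions.
Variables (R : realType) (N : nat).
Local Notation X := (@indet R N).
Local Notation C := (@ratfunC R N).

Lemma ratfunCD a b : C (a + b) = C a + C b.
Proof. by rewrite /ratfunC !rmorphD. Qed.
Lemma ratfunCM a b : C (a * b) = C a * C b.
Proof. by rewrite /ratfunC !rmorphM. Qed.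
Lemma ratfunC1 : C 1 = 1.
Proof. by rewrite /ratfunC !rmorph1. Qed.
Lemma ratfunCN a : C (- a) = - C a.
Proof. by rewrite /ratfunC !rmorphN. Qed.
Lemma ratfunC0 : C 0 = 0.
Proof. by rewrite /ratfunC !rmorph0. Qed.
Lemma ratfunCX a k : C (a ^+ k) = C a ^+ k.
Proof. by rewrite /ratfunC !rmorphXn. Qed.
Lemma ratfunC_eq0 a : (C a == 0) = (a == 0).
Proof. by rewrite /ratfunC tofrac_eq0 mpolyC_eq0. Qed.
Lemma ratfunCV a : C a^-1 = (C a)^-1.
Proof.
have [->|a0] := eqVneq a 0; first by rewrite invr0 ratfunC0 invr0.
apply: (@mulIf _ (C a)); first by rewrite ratfunC_eq0.
by rewrite -ratfunCM !mulVf ?ratfunC_eq0 // ratfunC1.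
Qed.

(** Inequalities between polynomials are reduced to their values at one well-chosen point. *)
Lemma tofrac_neq (p q : mpoly N R[i]) v : meval v p != meval v q ->
  FracField.tofrac p != FracField.tofrac q.
Proof. by apply: contraNneq => /eqP; rewrite tofrac_eq => /eqP ->. Qed.

Lemma indet_neq0 k : X k != 0.
Proof.
rewrite /indet -tofrac0; apply: (@tofrac_neq _ _ (fun=> 1)).
by rewrite mevalXU meval0 oner_eq0.
Qed.

(** The case k = l is kept, with a != 1, for the diagonal entries that arise when y = x. *)
Lemma indet_ratio m k l a : (0 < m)%N -> (k != l) || (a != 1) ->
  X k ^+ m != C a * X l ^+ m.
Proof.
move=> m0; rewrite /indet /ratfunC -!tofracXn -tofracM.
have [->|kl _] := eqVneq k l => /=.
  move=> a1; apply: (@tofrac_neq _ _ (fun=> 1)).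
  by rewrite mevalM mevalC !rmorphXn /= mevalXU expr1n mulr1 eq_sym.
(* At this point X_k is 1 and X_l is 0. *)
apply: (@tofrac_neq _ _ (fun i => (i == k)%:R)).
rewrite mevalM mevalC !rmorphXn /= !mevalXU eqxx (negPf (_ : l != k)) 1?eq_sym //.
by rewrite expr1n expr0n gtn_eqF // mulr0 eq_sym oner_eq0.
Qed.

Lemma indet_prod m k l a : (0 < m)%N -> a != 0 -> X k ^+ m * X l ^+ m != C a.
Proof.
move=> m0 a0; rewrite /indet /ratfunC -!tofracXn -tofracM.
apply: (@tofrac_neq _ _ (fun=> 0)).
by rewrite mevalM mevalC !rmorphXn /= !mevalXU expr0n gtn_eqF // mul0r eq_sym.
Qed.

Lemma indet_sum_inj m : (0 < m)%N -> injective (fun k => X k ^+ m + X k ^- m).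
Proof.
move=> m0 k l; apply: contra_eq => kl.
apply: addV_neq; [exact/expf_neq0/indet_neq0|exact/expf_neq0/indet_neq0| |].
  by have := @indet_ratio m k l 1 m0; rewrite kl ratfunC1 mul1r => ->.
by have := @indet_prod m k l 1 m0 (oner_neq0 _); rewrite ratfunC1.
Qed.

Lemma csum_indet_add k l : csum (X k) + csum (X l) != 0.
Proof.
have N1 : -1 != 1 :> R[i] by rewrite -subr_eq0 -opprD oppr_eq0 -mulr2n pnatr_eq0.
apply: addV_add_neq0; [exact/expf_neq0/indet_neq0|exact/expf_neq0/indet_neq0| |].
  by have := @indet_ratio 2 k l (-1) isT; rewrite N1 orbT ratfunCN ratfunC1 mulN1r; apply.
by have := @indet_prod 2 k l (-1) isT; rewrite oppr_eq0 oner_eq0 ratfunCN ratfunC1; apply.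
Qed.

(** Apply [quad_neq0] with d = z^2; on the diagonal the ratio conditions become z^2 != 1 and z^-2 !=
    1. *)
Lemma quad_indet k l z c : z != 0 -> (k != l) || (z ^+ 2 != 1) ->
  C z ^+ 2 + C z ^- 2 = c -> quad c (csum (X k)) (csum (X l)) != 0.
Proof.
move=> z0 klz <-; have b0 := expf_neq0 2 z0; rewrite -ratfunCX.
apply: quad_neq0; rewrite -?ratfunCV.
- by rewrite ratfunC_eq0.
- exact/expf_neq0/indet_neq0.
- exact/expf_neq0/indet_neq0.
- exact: indet_ratio.
- by apply: indet_ratio; rewrite // invr_eq1.
- exact: indet_prod.
- by apply: indet_prod; rewrite // invr_eq0.
Qed.

Lemma indet4_neq1 k : X k ^+ 4 != 1.
Proof.
by have := @indet_prod 2 k k 1 isT (oner_neq0 _); rewrite -exprD ratfunC1.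
Qed.

Lemma ratfunC_sum z c : z ^+ 2 + z ^- 2 = c -> C z ^+ 2 + C z ^- 2 = C c.
Proof. by move=> <-; rewrite ratfunCD ratfunCV ratfunCX. Qed.

End RationalFunctions.

Theorem theorem2p3 (R : realType) (n : nat) (hn : (1 <= n)%N) :
  let x := @xvar R n in
  let y := @yvar R n in
  let zt (m : nat) := ratfunC (n + n) (zeta R m) in
  [/\ AV x y (zt 4%N) =
        2 ^ (- (2 * n%:Z ^+ 2) + 2 * n%:Z)
        * \prod_(i < n) (x i ^ (- (2 * n%:Z) + 2) * y i ^ (- (2 * n%:Z) + 2))
        * \prod_(i < n) \prod_(j < n)
            ((x i ^+ 2 + y j ^+ 2) * (1 + x i ^+ 2 * y j ^+ 2))
        * permanent (\matrix_(i < n, j < n)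
            (1 / ((x i ^+ 2 + y j ^+ 2) * (1 + x i ^+ 2 * y j ^+ 2)))),
      AV x y (zt 6%N) =
        3 ^ (- (n%:Z * (n%:Z - 1)))
        * Sp (delta2 (n%:R - 1) (n%:R - 1))
            (joinv (fun i => x i ^+ 2) (fun i => y i ^+ 2)),
      AV x y (zt 8%N) =
        2 ^ (- (n%:Z * (n%:Z - 1)))
        * \prod_(i < n) (x i ^ (- (2 * n%:Z) + 2) * y i ^ (- (2 * n%:Z) + 2))
        * \prod_(i < n) \prod_(j < n | (i < j)%N)
            ((x i ^+ 2 + x j ^+ 2) * (1 + x i ^+ 2 * x j ^+ 2)
             * (y i ^+ 2 + y j ^+ 2) * (1 + y i ^+ 2 * y j ^+ 2))
    & AV x x (zt 12%N) =
        1 / (\prod_(i < n) (x i ^+ 2 + x i ^- 2))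
        * Ot (delta2 (n%:R / 2) (n%:R / 2 - 1)) x
        * Ot (delta2 ((n%:R - 1) / 2) ((n%:R - 1) / 2)) x].
Proof.
move=> x y zt.
have zt0 m : (0 < m)%N -> zt (m + m)%N != 0.
  by move=> m0; rewrite ratfunC_eq0 zeta_neq0.
have x0 i : x i != 0 by apply: indet_neq0.
have y0 i : y i != 0 by apply: indet_neq0.
have x4 i : x i ^+ 4 != 1 by apply: indet4_neq1.
have y4 i : y i ^+ 4 != 1 by apply: indet4_neq1.
have injx : injective (@csum _ \o x).
  exact: (inj_comp (indet_sum_inj (m := 2) isT) (@lshift_inj n n)).
have injy : injective (@csum _ \o y).
  exact: (inj_comp (indet_sum_inj (m := 2) isT) (@rshift_inj n n)).
have injx3 : injective (@csum3 _ \o x).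
  exact: (inj_comp (indet_sum_inj (m := 6) isT) (@lshift_inj n n)).
have injy3 : injective (@csum3 _ \o y).
  exact: (inj_comp (indet_sum_inj (m := 6) isT) (@rshift_inj n n)).
have lr i j : lshift n i != rshift n j :> 'I_(n + n) by rewrite eq_lrshift.
have c4 : zt 4%N ^+ 2 + zt 4%N ^- 2 = -2.
  by rewrite (ratfunC_sum _ (zeta4_sum R)) ratfunCN mulr2n ratfunCD ratfunC1.
have c6 : zt 6%N ^+ 2 + zt 6%N ^- 2 = -1.
  by rewrite (ratfunC_sum _ (zeta6_sum R)) ratfunCN ratfunC1.
have c8 : zt 8%N ^+ 2 + zt 8%N ^- 2 = 0.
  by rewrite (ratfunC_sum _ (zeta8_sum R)) ratfunC0.
have c12 : zt 12%N ^+ 2 + zt 12%N ^- 2 = 1.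
  by rewrite (ratfunC_sum _ (zeta12_sum R)) ratfunC1.
have a4 : zt 4%N != 0 := zt0 2 isT.
have a6 : zt 6%N != 0 := zt0 3 isT.
have a8 : zt 8%N != 0 := zt0 4 isT.
have a12 : zt 12%N != 0 := zt0 6 isT.
have xx i j : csum (x i) + csum (x j) != 0 by apply: csum_indet_add.
have xy i j : csum (x i) + csum (y j) != 0 by apply: csum_indet_add.
have yy i j : i != j -> csum (y i) + csum (y j) != 0 by move=> _; apply: csum_indet_add.
have xy' i j : csum (x i) - csum (y j) != 0.
  rewrite subr_eq0; apply: contra_neq (lr i j).
  exact: (indet_sum_inj (m := 2) isT).
have D6 i j : quad (-1) (csum (x i)) (csum (y j)) != 0.
  by apply: quad_indet c6; rewrite ?lr // (@zeta_neq0 R 3).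
have D8 i j : quad 0 (csum (x i)) (csum (y j)) != 0.
  by apply: quad_indet c8; rewrite ?lr // (@zeta_neq0 R 4).
have D12 i j : quad 1 (csum (x i)) (csum (x j)) != 0.
  apply: quad_indet c12; first exact: (@zeta_neq0 R 6).
  (* Indices may coincide here because y = x. If the square of the root were 1, the sum in
     [zeta12_sum] would be 2 instead of 1. *)
  apply/orP; right; apply/eqP => z1; have := zeta12_sum R.
  by rewrite z1 invr1 -[RHS]addr0 => /addrI/eqP; rewrite oner_eq0.
(* Otherwise unification unfolds the operations of the field of fractions. *)
clear zt0 lr; clearbody zt x y.
split.
- exact (AV_borchardt hn x0 y0 a4 x4 y4 c4 xy injx injy).
- exact (AV_symplectic hn x0 y0 a6 x4 y4 c6 D6 injx injy injy3 yy xy xy').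
- exact (AV_cauchy hn x0 y0 a8 x4 y4 c8 D8 injx injy yy).
- exact (AV_orthogonal hn x0 a12 x4 c12 D12 injx injx3 xx).
Qed.
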